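(* There exist absolute constants $c_1,c_2>0$ such that the following holds. Let $\mu,\nu$ be centered log-concave probability measures on $\mathbb{R}^n$ with densities satisfying $\|f_\mu\|_\infty=\|f_\nu\|_\infty$. Let $X_1,X_2,\ldots$ be independent random points distributed according to $\mu$ and $K_N=\mathrm{conv}\{X_1,\ldots,X_N\}$. Then for every $N>n$ with $N\leq\exp(c_1n/L_\mu^2)$, $$\mathbb{E}_{\mu^N}(\nu(K_N))\leq 2\exp\left(-c_2n/L_\mu^2\right).$$
   Context: A log-concave probability measure on $\mathbb{R}^n$ is a Borel probability measure with $\mu(\lambda A+(1-\lambda)B)\geq\mu(A)^\lambda\mu(B)^{1-\lambda}$ for compact $A,B$, $\lambda\in(0,1)$, and $\mu(H)<1$ for every hyperplane $H$; it has density $f_\mu$. Centered means barycenter at $0$. $L_\mu=\|f_\mu\|_\infty^{1/n}[\det\mathrm{Cov}(\mu)]^{1/(2n)}$. *)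

(* Defs.v *)
From HB Require Import structures.
From mathcomp Require Import all_boot all_order all_algebra.
From mathcomp Require Import all_classical all_reals all_analysis ess_sup_inf.
Set Implicit Arguments. Unset Strict Implicit. Unset Printing Implicit Defensive.
Import Order.TTheory GRing.Theory Num.Theory.
Import numFieldNormedType.Exports.
Local Open Scope classical_set_scope.
Local Open Scope ring_scope.

Record sfspace (R : realType) := SFS {
  sf_disp : measure_display;
  sf_type : measurableType sf_disp;
  sf_meas : {sigma_finite_measure set sf_type -> \bar R} }.

Definition unit_sfspace (R : realType) : sfspace R :=
  @SFS R _ unit (@dirac _ unit tt R).

Section product_sigma_finite.
Context d1 d2 (T1 : measurableType d1) (T2 : measurableType d2) (R : realType).
Variable m1 : {sigma_finite_measure set T1 -> \bar R}.
Variable m2 : {sigma_finite_measure set T2 -> \bar R}.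

Definition prod_meas_fun : set (T1 * T2) -> \bar R := (m1 \x m2)%E.

HB.instance Definition _ := Measure.copy prod_meas_fun (m1 \x m2)%E.

Let prod_meas_sigma_finite : sigma_finite setT prod_meas_fun.
Proof.
have /sigma_finiteP[F [TF ndF Foo]] := sigma_finiteT m1.
have /sigma_finiteP[G [TG ndG Goo]] := sigma_finiteT m2.
exists (fun n => F n `*` G n).
 rewrite -setXTT TF TG predeqE => -[x y]; split.
    move=> [/= [n _ Fnx] [k _ Gky]]; exists (maxn n k) => //; split.
    - by move: x Fnx; exact/subsetPset/ndF/leq_maxl.
    - by move: y Gky; exact/subsetPset/ndG/leq_maxr.
  by move=> [n _ []/= ? ?]; split; exists n.
move=> k; have [? ?] := Foo k; have [? ?] := Goo k.
split; first exact: measurableX.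
by rewrite /prod_meas_fun product_measure1E// lte_mul_pinfty// ge0_fin_numE.
Qed.

HB.instance Definition _ := Measure_isSigmaFinite.Build _ _ _ prod_meas_fun
  prod_meas_sigma_finite.

Definition prod_meas : {sigma_finite_measure set (T1 * T2)%type -> \bar R} :=
  prod_meas_fun.
End product_sigma_finite.

Definition prod_sfspace (R : realType) (S1 S2 : sfspace R) : sfspace R :=
  @SFS R _ (sf_type S1 * sf_type S2)%type (prod_meas (sf_meas S1) (sf_meas S2)).

Fixpoint pow_sfspace (R : realType) (S : sfspace R) (n : nat) : sfspace R :=
  match n with
  | 0 => unit_sfspace R
  | k.+1 => prod_sfspace S (pow_sfspace S k)
  end.

Fixpoint pow_nth (R : realType) (S : sfspace R) (V : Type) (f : sf_type S -> V)
  (dflt : V) (n : nat) : sf_type (pow_sfspace S n) -> nat -> V :=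
  match n return sf_type (pow_sfspace S n) -> nat -> V with
  | 0 => fun _ _ => dflt
  | k.+1 => fun x i => match i with
                       | 0 => f x.1
                       | i'.+1 => @pow_nth R S V f dflt k x.2 i'
                       end
  end.

(** * Euclidean space R^n, with its Borel sigma-algebra and Lebesgue measure,
      realised as the n-fold product  R * (R * ( ... * (R * unit)))  *)

Definition leb_sfspace (R : realType) : sfspace R :=
  @SFS R _ (measurableTypeR R) (@lebesgue_measure R).

Definition Rn (R : realType) (n : nat) : measurableType _ :=
  sf_type (pow_sfspace (leb_sfspace R) n).

Definition lebn (R : realType) (n : nat) : {sigma_finite_measure set Rn R n -> \bar R} :=
  sf_meas (pow_sfspace (leb_sfspace R) n).

Definition vecn (R : realType) (n : nat) (x : Rn R n) : 'rV[R]_n :=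
  \row_(i < n) @pow_nth R (leb_sfspace R) R (fun t => t) 0 n x i.

Definition conv_hull (R : realType) (n N : nat) (X : 'I_N -> 'rV[R]_n) : set 'rV[R]_n :=
  [set y | exists w : 'I_N -> R, (forall i, 0 <= w i) /\ \sum_(i < N) w i = 1
                                  /\ y = \sum_(i < N) w i *: X i].

Definition mink_comb (R : realType) (n : nat) (l : R) (A B : set (Rn R n)) : set (Rn R n) :=
  [set x | exists a b, A a /\ B b /\ vecn x = l *: vecn a + (1 - l) *: vecn b].

Definition hyperplane (R : realType) (n : nat) (u : 'rV[R]_n) (c : R) : set (Rn R n) :=
  [set x | \sum_(i < n) u 0 i * vecn x 0 i = c].

Definition log_concave (R : realType) (n : nat) (mu : probability (Rn R n) R) : Prop :=
  (forall (A B : set (Rn R n)) (l : R),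
      compact (@vecn R n @` A) -> compact (@vecn R n @` B) -> 0 < l < 1 ->
      (fine (mu A)) `^ l * (fine (mu B)) `^ (1 - l) <= fine (mu (mink_comb l A B)))
  /\ (forall (u : 'rV[R]_n) (c : R), u != 0 ->
      (mu (hyperplane u c) < 1)%E).

Definition is_density (R : realType) (n : nat) (mu : probability (Rn R n) R)
    (f : Rn R n -> R) : Prop :=
  measurable_fun setT f /\ (forall x, 0 <= f x) /\
  forall A, measurable A -> mu A = (\int[lebn R n]_(x in A) (f x)%:E)%E.

Definition sup_norm (R : realType) (n : nat) (f : Rn R n -> R) : \bar R :=
  ess_sup (lebn R n) (fun x => (f x)%:E).

Definition barycenter (R : realType) (n : nat) (mu : probability (Rn R n) R) : 'rV[R]_n :=
  \row_(i < n) fine (\int[mu]_x (vecn x 0 i)%:E)%E.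

Definition centered (R : realType) (n : nat) (mu : probability (Rn R n) R) : Prop :=
  forall i : 'I_n, mu.-integrable setT (fun x => (vecn x 0 i)%:E) /\
                   (\int[mu]_x (vecn x 0 i)%:E = 0)%E.

Definition Cov (R : realType) (n : nat) (mu : probability (Rn R n) R) : 'M[R]_n :=
  \matrix_(i < n, j < n)
    fine (\int[mu]_x ((vecn x 0 i - barycenter mu 0 i) *
                      (vecn x 0 j - barycenter mu 0 j))%:E)%E.

Definition isotropic_const (R : realType) (n : nat) (mu : probability (Rn R n) R)
    (f : Rn R n -> R) : R :=
  (fine (sup_norm f)) `^ (n%:R^-1) * (\det (Cov mu)) `^ ((2 * n%:R)^-1).

Definition prob_sfspace (R : realType) (n : nat) (mu : probability (Rn R n) R) : sfspace R :=
  @SFS R _ (Rn R n) mu.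

Definition prod_pow (R : realType) (n : nat) (mu : probability (Rn R n) R) (N : nat) :
  {sigma_finite_measure set sf_type (pow_sfspace (prob_sfspace mu) N) -> \bar R} :=
  sf_meas (pow_sfspace (prob_sfspace mu) N).

Definition sample_pt (R : realType) (n : nat) (mu : probability (Rn R n) R) (N : nat)
    (w : sf_type (pow_sfspace (prob_sfspace mu) N)) (i : 'I_N) : 'rV[R]_n :=
  @pow_nth R (prob_sfspace mu) 'rV[R]_n (@vecn R n) 0 N w i.

Definition random_polytope (R : realType) (n : nat) (mu : probability (Rn R n) R) (N : nat)
    (w : sf_type (pow_sfspace (prob_sfspace mu) N)) : set (Rn R n) :=
  @vecn R n @^-1` conv_hull (sample_pt w).

(* Main.v *)
Require Import Defs.
From HB Require Import structures.
From mathcomp Require Import all_boot all_order all_algebra.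
From mathcomp Require Import all_classical all_reals all_analysis ess_sup_inf.
From mathcomp Require Import measurable_realfun ring lra.

(* Let [S] be the sum of [k] independent points of law [mu], and suppose a closed convex set [C]
   carries all but [exp(-2n)] of the law of [S].  If [k x] is not in [C], and [k] independent
   copies of the random polytope all contain [x], then [k x] is a weighted mean of the [N^k] sums
   obtained by drawing one vertex in each copy, so by convexity one of these sums avoids [C].
   Hence [P(x in K_N)^k <= N^k exp(-2n)].

   For [C] take a superlevel set of [Phi a = P(|S - a| <= e)].  Prekopa-Leindler with respect to
   [mu] makes [Phi] log-concave, so [C] is convex; Markov's inequality bounds its volume, and
   log-concavity bounds [P(S notin C)] by integrating [sqrt Phi].  Both bounds involve [max Phi],
   and comparing the covariance of [S] with a Gaussian gives
   [max Phi / e^n >= c^n / (k^(n/2) sqrt(det Cov))].  Therefore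
   [nu {x | k x in C} <= |f|_oo vol C / k^n <= (A L_mu / sqrt k)^n], and [k ~ (e A L_mu)^2] makes
   both [nu {x | k x in C}] and [N exp(-2n/k)] exponentially small in [n / L_mu^2].
   The case [k = 1], [nu = mu] yields the lower bound [L_mu >= 1/(2A)]. *)

Set Implicit Arguments. Unset Strict Implicit. Unset Printing Implicit Defensive.
Import Order.TTheory GRing.Theory Num.Theory.
Import numFieldNormedType.Exports.
Local Open Scope classical_set_scope.
Local Open Scope ring_scope.

(** * Measurability in R^n *)

(** A single point instead of [k] gives only the bound [(A L_mu)^n] for [nu C], void once
    [A L_mu >= 1]. The mean of [k] points spreads [sqrt k] times less, which shrinks the set
    accordingly, at the price of a [k]-th root of [exp(-2n)]. So [k] is taken just large enough for
    [sqrt k] to beat [A L_mu], and this is where [n / L_mu^2] comes from. Log-concavity is an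
    inequality between measures of sets, and no density of [S] is at hand. Box masses at scale [e]
    replace it; [e^n] cancels between the lower bound for the maximum and the volume bound, so [e]
    may be as small as the Gaussian comparison requires. Adding a point to the sum is an integration
    against [mu], so the inequality for sets must first become one for integrals. The covariance is
    made of [fine] parts of integrals, hence finiteness of second moments has to be proved. It is
    drawn from the same integral inequality, which for this reason admits an infinite integral on
    the left. *)

Section rn.
Context {R : realType}.

Definition rn_coord n (x : Rn R n) (i : nat) : R :=
  @pow_nth R (leb_sfspace R) R id 0 n x i.

Fixpoint mkRn n (g : nat -> R) : Rn R n :=
  match n return Rn R n with
  | 0 => tt
  | k.+1 => (g 0, mkRn k (fun i => g i.+1))
  end.

(** The sigma-algebra lives on the iterated product [Rn R n], topology and linear algebra on
    ['rV[R]_n]. The default [0] is never read, since [mkRn n] evaluates its argument only below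
    [n]. *)
Definition unvec n (v : 'rV[R]_n) : Rn R n :=
  mkRn n (fun i => if insub i is Some j then v 0 j else 0).

Lemma coord_mkRn n g i : (i < n)%N -> rn_coord (mkRn n g) i = g i.
Proof. by elim: n g i => //= n IH g [|i] //= lin; rewrite /rn_coord/= -/(rn_coord _ _) IH. Qed.

Lemma vecnE n (x : Rn R n) (i : 'I_n) : vecn x 0 i = rn_coord x i.
Proof. by rewrite mxE. Qed.

Lemma unvecK n : cancel (@unvec n) (@vecn R n).
Proof.
move=> v; apply/rowP => i; rewrite vecnE coord_mkRn ?ltn_ord//.
by rewrite valK.
Qed.

Lemma measurable_coord n i : measurable_fun setT (fun x : Rn R n => rn_coord x i).
Proof.
elim: n i => [|n IH] [|i].
- exact: measurable_cst.
- exact: measurable_cst.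
- exact: (@measurable_fst _ _ (measurableTypeR R) (Rn R n)).
- exact: (measurableT_comp (IH i) (@measurable_snd _ _ (measurableTypeR R) (Rn R n))).
Qed.

Lemma measurable_Rn d (T : measurableType d) n (f : T -> Rn R n) :
  (forall i, (i < n)%N -> measurable_fun setT (fun t => rn_coord (f t) i)) ->
  measurable_fun setT f.
Proof.
elim: n f => [|n IH] f h.
  move=> _ A mA; rewrite setTI.
  have [Att|Att] := pselect (A tt).
    rewrite (_ : f @^-1` A = setT) //.
    by rewrite -subTset => t _; rewrite /preimage/=; case: (f t).
  rewrite (_ : f @^-1` A = set0) //.
  by rewrite -subset0 => t; rewrite /preimage/=; case: (f t).
apply/(@measurable_fun_pairP _ _ _ _ (measurableTypeR R) (Rn R n)); split.
  exact: (h 0%N).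
by apply: IH => i lin; exact: (h i.+1).
Qed.

End rn.

Section rv.
Context {R : realType}.

Lemma rV_norm_le n (v : 'rV[R]_n) r : 0 <= r ->
  (`|v| <= r) <-> (forall i, `|v 0 i| <= r).
Proof.
move=> r0; rewrite {1}/Num.norm/= mx_normrE; split.
  by move=> /bigmax_leP[_ h] i; exact: (h (0, i)).
move=> h; apply/bigmax_leP; split => // -[i j] _ /=.
by rewrite (ord1 i).
Qed.

Lemma rV_norm_lt n (v : 'rV[R]_n) r : 0 < r ->
  (`|v| < r) <-> (forall i, `|v 0 i| < r).
Proof.
move=> r0; rewrite {1}/Num.norm/= mx_normrE; split.
  by move=> /bigmax_ltP[_ h] i; exact: (h (0, i)).
move=> h; apply/bigmax_ltP; split => // -[i j] _ /=.
by rewrite (ord1 i).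
Qed.

Lemma rV_coord_le n (v : 'rV[R]_n) i : `|v 0 i| <= `|v|.
Proof. by have /(rV_norm_le v (normr_ge0 v)) := lexx `|v|; exact. Qed.

(* Measurability of a function into ['rV[R]_n], which carries no sigma-algebra. *)
Definition mvec d (T : measurableType d) n (X : T -> 'rV[R]_n) :=
  forall i, measurable_fun setT (fun t => X t 0 i).

Lemma mvec_vecn n : mvec (@vecn R n).
Proof.
by move=> i; under eq_fun do rewrite vecnE; exact: measurable_coord.
Qed.

Lemma mvec_unvec d (T : measurableType d) n (X : T -> 'rV[R]_n) :
  mvec X -> measurable_fun setT (fun t => unvec (X t)).
Proof.
move=> mX; apply: measurable_Rn => i lin.
have := mX (Ordinal lin); congr measurable_fun; apply/funext => t.
by rewrite -[in LHS](unvecK (X t)) vecnE.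
Qed.

Lemma mvec_cst d (T : measurableType d) n (a : 'rV[R]_n) : mvec (fun _ : T => a).
Proof. by move=> i; exact: measurable_cst. Qed.

Lemma mvecD d (T : measurableType d) n (X Y : T -> 'rV[R]_n) :
  mvec X -> mvec Y -> mvec (fun t => X t + Y t).
Proof.
by move=> mX mY i; under eq_fun do rewrite mxE; exact: measurable_funD.
Qed.

Lemma mvecZ d (T : measurableType d) n (c : R) (X : T -> 'rV[R]_n) :
  mvec X -> mvec (fun t => c *: X t).
Proof.
by move=> mX i; under eq_fun do rewrite mxE; exact: measurable_funM.
Qed.

Lemma mvecB d (T : measurableType d) n (X Y : T -> 'rV[R]_n) :
  mvec X -> mvec Y -> mvec (fun t => X t - Y t).
Proof.
by move=> mX mY i; under eq_fun do rewrite !mxE; exact: measurable_funB.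
Qed.

Lemma mvec_comp d d' (T : measurableType d) (U : measurableType d') n
  (X : U -> 'rV[R]_n) (f : T -> U) :
  mvec X -> measurable_fun setT f -> mvec (X \o f).
Proof. by move=> mX mf i; exact: (measurableT_comp (mX i) mf). Qed.

(** The map factors as [Phi \o @vecn R n] after [unvec \o X], both between genuine measurable
    spaces. *)
Lemma mvec_rn d (T : measurableType d) n d' (U : measurableType d')
  (Phi : 'rV[R]_n -> U) (X : T -> 'rV[R]_n) :
  measurable_fun setT (Phi \o @vecn R n) -> mvec X -> measurable_fun setT (Phi \o X).
Proof.
move=> mPhi /mvec_unvec mX.
have := measurableT_comp mPhi mX; congr measurable_fun.
by apply/funext => t /=; rewrite unvecK.
Qed.

Lemma measurable_ball_vecn n (q : 'rV[R]_n) r : 0 < r ->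
  measurable (@vecn R n @^-1` [set v | `|v - q| < r]).
Proof.
move=> r0.
rewrite (_ : _ @^-1` _ = \bigcap_(i in [set: 'I_n])
   ((fun x : Rn R n => `|vecn x 0 i - q 0 i|) @^-1` `]-oo, r[)).
  apply: fin_bigcap_measurable => // i _; rewrite -[X in measurable X]setTI.
  have /(_ measurableT) : measurable_fun setT (fun x : Rn R n => `|vecn x 0 i - q 0 i|).
    apply: measurableT_comp => //; apply: measurable_funB => //.
    exact: mvec_vecn.
  exact.
apply/seteqP; split => x /=.
  by move/(rV_norm_lt _ r0) => h i _ /=; have := h i; rewrite !mxE in_itv/=.
move=> h; apply/(rV_norm_lt _ r0) => i; have := h i I.
by rewrite /= in_itv/= !mxE.
Qed.

(** The norm is the sup norm, so a ball is a finite intersection of coordinate strips, and an open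
    set is the union of the countably many balls inside it with rational centre and radius
    [1/(k+1)]. *)
Lemma measurable_open_vecn n (U : set 'rV[R]_n) : open U ->
  measurable (@vecn R n @^-1` U).
Proof.
move=> oU.
pose B (p : 'rV[rat]_n * nat) := [set v : 'rV[R]_n | `|v - map_mx ratr p.1| < p.2.+1%:R^-1].
pose F p := if `[< B p `<=` U >] then @vecn R n @^-1` B p else set0.
rewrite (_ : _ @^-1` U = \bigcup_p F p).
  apply: countable_bigcupT_measurable => [|p]; [exact: countableP|rewrite /F; case: ifP => // _].
  by apply: measurable_ball_vecn; rewrite invr_gt0 ltr0Sn.
apply/seteqP; split => x /=; last first.
  by move=> [p _]; rewrite /F; case: ifPn => // /asboolP BU; exact: BU.
move=> Ux.
have /nbhs_ballP[e /= e0 eU] : nbhs (vecn x) U by exact: open_nbhs_nbhs.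
have [k ke] : exists k : nat, k.+1%:R^-1 < e / 2.
  have := near_infty_natSinv_lt (PosNum (divr_gt0 e0 (@ltr0Sn R 1))).
  by move=> /filter_ex[k]; exists k.
have k0 : 0 < k.+1%:R^-1 :> R by rewrite invr_gt0 ltr0Sn.
have hq i : exists q : rat, `|vecn x 0 i - ratr q| < k.+1%:R^-1.
  have /rat_in_itvoo[q] : vecn x 0 i - k.+1%:R^-1 < vecn x 0 i + k.+1%:R^-1.
    by rewrite ltrBlDr -addrA ltrDl addr_gt0.
  rewrite in_itv/= => /andP[q1 q2]; exists q.
  by rewrite distrC ltr_distl q1 q2.
pose q := \row_i projT1 (cid (hq i)).
have xB : B (q, k) (vecn x).
  rewrite /B/=; apply/rV_norm_lt => // i;
  have -> : (vecn x - map_mx ratr q) 0 i = vecn x 0 i - ratr (q 0 i) by rewrite !mxE.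
  rewrite [q 0 i]mxE.
  by case: (cid (hq i)).
exists (q, k) => //; rewrite /F asboolT//= => v Bv.
apply: eU; rewrite -ball_normE /ball_/= (le_lt_trans (ler_distD (map_mx ratr q) _ _))//.
rewrite [X in _ < X]splitr ltrD//.
  exact: lt_trans xB ke.
by rewrite distrC; exact: lt_trans Bv ke.
Qed.

Lemma measurable_closed_vecn n (C : set 'rV[R]_n) : closed C ->
  measurable (@vecn R n @^-1` C).
Proof.
move=> cC; rewrite -[X in measurable X]setCK; apply: measurableC.
by apply: (measurable_open_vecn (closed_openC cC)).
Qed.

Lemma measurable_closed_mvec d (T : measurableType d) n (X : T -> 'rV[R]_n)
  (C : set 'rV[R]_n) : mvec X -> closed C -> measurable (X @^-1` C).
Proof.
move=> mX cC; have := mvec_unvec mX measurableT (measurable_closed_vecn cC).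
rewrite setTI; congr measurable.
by apply/funext => t; rewrite /preimage/= unvecK.
Qed.

Lemma closed_rVP n (C : set 'rV[R]_n) : closed C <->
  forall v, ~ C v -> exists2 e : R, 0 < e & forall w, `|w - v| < e -> ~ C w.
Proof.
rewrite -openC openE; split => [oC v /oC /nbhs_ballP[e /= e0 h]|h v /h[e e0 eC]].
  by exists e => // w we; apply: h; rewrite -ball_normE /ball_/= distrC.
apply/nbhs_ballP; exists e => //= w; rewrite -ball_normE /ball_/= distrC.
exact: eC.
Qed.

Lemma closed_rV_ball n (a : 'rV[R]_n) r : closed [set v | `|v - a| <= r].
Proof.
apply/closed_rVP => v /= /negP; rewrite -ltNge => h.
exists (`|v - a| - r); first by rewrite subr_gt0.
move=> w; have := ler_distD w v a; rewrite (distrC v w) => h1 h2.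
apply/negP; rewrite -ltNge; lra.
Qed.

Lemma compact_vecn n (C : set 'rV[R]_n) : compact C ->
  compact (@vecn R n @` (@vecn R n @^-1` C)).
Proof.
rewrite image_preimage// -subTset => v _; exists (unvec v) => //.
exact: unvecK.
Qed.

End rv.

(** * The Prekopa-Leindler inequality *)

Section tonelli_set.
Local Open Scope ereal_scope.
Context d1 d2 (T1 : measurableType d1) (T2 : measurableType d2) {R : realType}.
Variables (m1 : {sigma_finite_measure set T1 -> \bar R})
  (m2 : {sigma_finite_measure set T2 -> \bar R}).

Lemma measurable_section2 (A : set (T1 * T2)) : measurable A ->
  measurable_fun setT (fun y => m1 [set x | A (x, y)]).
Proof.
move=> mA; have := measurable_fun_ysection m1 mA; congr measurable_fun.
by apply/funext => x /=; rewrite ysectionE.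
Qed.

Lemma tonelli_set (A : set (T1 * T2)) : measurable A ->
  \int[m1]_x m2 [set y | A (x, y)] = \int[m2]_y m1 [set x | A (x, y)].
Proof.
move=> mA; have := indic_fubini_tonelli m1 m2 mA.
rewrite (indic_fubini_tonelli_FE m2 mA) (indic_fubini_tonelli_GE m1 mA).
under eq_integral do rewrite /= xsectionE.
move=> ->.
by under eq_integral do rewrite /= ysectionE.
Qed.

Lemma measurable_slice1 (A : set (T1 * T2)) x : measurable A -> measurable [set y | A (x, y)].
Proof. by move=> /(measurable_xsection x); rewrite xsectionE. Qed.

Lemma measurable_slice2 (A : set (T1 * T2)) y : measurable A -> measurable [set x | A (x, y)].
Proof. by move=> /(measurable_ysection y); rewrite ysectionE. Qed.

End tonelli_set.

(** * The one-dimensional inequality *)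

Section leb1.
Context {R : realType}.
Local Notation leb := (@lebesgue_measure R).

(** The image of [leb] under a translation agrees with [leb] on half-open intervals, which determine
    it. *)
Lemma lebesgue_measureD (c : R) (A : set R) : measurable A ->
  leb ((fun x => x + c) @^-1` A) = leb A.
Proof.
move=> mA; apply/esym.
have mc : measurable_fun setT ((fun x => x + c) : measurableTypeR R -> measurableTypeR R).
  exact: measurable_funD.
apply: (@lebesgue_measure_unique R (pushforward leb (fun x : measurableTypeR R => x + c : measurableTypeR R)))
  => // _ [[a b]] _ <-.
have E : (fun x => x + c) @^-1` `]a, b]%classic = `](a - c), (b - c)]%classic.
  by apply/seteqP; split=> x /=; rewrite !in_itv/= => /andP[? ?]; apply/andP; split; lra.
transitivity (leb `](a - c), (b - c)]%classic); last first.
  by rewrite -E.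
rewrite !lebesgue_measure_itv/= !lte_fin ltrD2r; case: ifP => // _.
by rewrite -!EFinD; congr EFin; lra.
Qed.

(* Any [a \in A] nearly maximal and [b \in B] nearly minimal give translates [a + B] and
   [A + b] of [B] and [A] inside [C] which barely overlap. *)
Lemma brunn_minkowski1 (A B C : set R) M :
  measurable A -> measurable B -> measurable C -> A !=set0 -> B !=set0 ->
  (forall x, A x -> `|x| <= M) -> (forall x, B x -> `|x| <= M) ->
  (forall a b, A a -> B b -> C (a + b)) -> (leb A + leb B <= leb C)%E.
Proof.
move=> mA mB mC A0 B0 bA bB ABC.
have hA : has_sup A.
  by split => //; exists M => x /bA; rewrite ler_norml => /andP[].
have hB : has_inf B.
  by split => //; exists (- M) => x /bB; rewrite ler_norml => /andP[].
apply/lee_addgt0Pr => e e0.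
have e20 : 0 < e / 2 by rewrite divr_gt0.
have [a Aa ha] := sup_adherent e20 hA.
have [b Bb hb] := inf_adherent e20 hB.
pose A' := (fun x => x + - b) @^-1` A.
pose B' := (fun x => x + - a) @^-1` B.
have mA' : measurable A'.
  rewrite -[A']setTI.
  apply: (_ : measurable_fun setT ((fun x => x + - b) : measurableTypeR R -> measurableTypeR R)) => //.
  exact: measurable_funD.
have mB' : measurable B'.
  rewrite -[B']setTI.
  apply: (_ : measurable_fun setT ((fun x => x + - a) : measurableTypeR R -> measurableTypeR R)) => //.
  exact: measurable_funD.
have A'C : A' `<=` C.
  by move=> x /= /ABC /(_ Bb); rewrite subrK.
have B'C : B' `<=` C.
  by move=> x /= /(ABC _ _ Aa); rewrite addrC subrK.
(* This interval has length [(sup A - a) + (b - inf B)], and each term is below [e / 2]. *)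
have I : A' `&` B' `<=` `[a + inf B, sup A + b]%classic.
  move=> x [/= xA xB]; rewrite in_itv/=; apply/andP; split.
    have := ge_inf (proj2 hB) xB; lra.
  have := sup_upper_bound hA xA; lra.
have lI : (leb (A' `&` B') <= e%:E)%E.
  apply: (@le_trans _ _ (leb `[a + inf B, sup A + b]%classic)).
    by apply: le_measure => //; rewrite inE//; exact: measurableI.
  rewrite lebesgue_measure_itv/=; case: ifP => _; last by rewrite lee_fin ltW.
  by rewrite -EFinB lee_fin; lra.
rewrite -(lebesgue_measureD (- b) mA) -(lebesgue_measureD (- a) mB) -/A' -/B'.
have -> : A' = (A' `\` B') `|` (A' `&` B') by rewrite setUC setUIDK.
rewrite measureU//; [|exact: measurableD|exact: measurableI|].
  rewrite addeAC -measureU//; [|exact: measurableD|].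
    apply: leeD => //; apply: le_measure; rewrite ?inE//.
      by apply: measurableU => //; exact: measurableD.
    by rewrite subUset; split => //; apply: subset_trans A'C; exact: subDsetl.
  by rewrite setDKI.
by rewrite -subset0 => x [[_ nB] [_ /nB]].
Qed.

End leb1.

Section layer.
Context {R : realType}.
Local Notation leb := (@lebesgue_measure R).

(** With [t = expR (- (c * s))] the integrand becomes [dt / c] on [0 < t <= h]. *)
Lemma expR_layer (c h : R) : 0 < c -> 0 <= h ->
  (\int[leb]_s (expR (- (c * s)) * (expR (- (c * s)) <= h)%R%:R)%:E = (h / c)%:E)%E.
Proof.
move=> c0; rewrite le_eqVlt => /predU1P[<-|h0].
  rewrite mul0r integral0_eq// => s _.
  by rewrite leNgt expR_gt0/= mulr0.
pose a := - (ln h / c).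
transitivity (\int[leb]_(s in `[a, +oo[) (expR (- (c * s)))%:E)%E.
  rewrite [RHS]integral_mkcond; apply: eq_integral => s _; rewrite patchE.
  have -> : (expR (- (c * s)) <= h) = (s \in `[a, +oo[%classic).
    rewrite mem_setE in_itv/= andbT -{1}(lnK h0) ler_expR /a.
    by rewrite [RHS]lerNl ler_pdivlMr// mulNr [s * c]mulrC.
  by case: (s \in _); rewrite ?mulr1 ?mulr0.
have d (x : R) : is_derive x 1 (fun s : R => - (expR (- (c * s)) / c)) (expR (- (c * x))).
  apply: is_derive_eq; rewrite /GRing.scale/=.
  by rewrite mulr1; field; rewrite gt_eqF.
have cf (x : R) : {for x, continuous (fun s : R => expR (- (c * s)))}.
  apply: differentiable_continuous; apply/derivable1_diffP.
  by apply: ex_derive.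
rewrite (@ge0_continuous_FTC2y _ _ (fun s : R => - (expR (- (c * s)) / c)) a 0)//.
- rewrite /a mulrN opprK mulrCA divff ?gt_eqF// mulr1 lnK//.
  by rewrite -EFinB sub0r opprK.
- by apply: continuous_subspaceT => x; exact: cf.
- rewrite -[X in _ --> X]oppr0 -(mul0r c^-1).
  apply: cvgN; apply: cvgMl.
  apply: (@cvg_comp _ _ _ (fun s : R => c * s) (fun s => expR (- s)) _ +oo%R).
    exact: gt0_cvgMry.
  exact: cvgr_expR.
- have : {for a, continuous (fun s : R => - (expR (- (c * s)) / c))}.
    by apply: differentiable_continuous; apply/derivable1_diffP; apply: ex_derive.
  exact: cvg_at_right_filter.
- by move=> x _; rewrite derive1E; exact: derive_val.
Qed.

(** Layer cake with levels rescaled to [0 < r < 1]. When [c] bounds [f] the minimum is inactive;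
    when it does not, cutting at [1] only loses mass, which is harmless for the function on the
    larger side. *)
Lemma layer01 d (T : measurableType d) (m : {sigma_finite_measure set T -> \bar R})
  (f : T -> R) (c : R) : measurable_fun setT f -> 0 < c -> (forall x, 0 <= f x) ->
  (\int[leb]_r m [set x | (0 < r < 1)%R /\ (r * c <= f x)%R] = \int[m]_x (Num.min (f x / c) 1)%:E)%E.
Proof.
move=> mf c0 f0.
pose A := [set z : T * measurableTypeR R | 0 < z.2 < 1 /\ z.2 * c <= f z.1].
have mA : measurable A.
  have -> : A = (snd @^-1` `]0, 1[%classic) `&`
      (fun z : T * measurableTypeR R => f z.1 - z.2 * c) @^-1` `[0, +oo[%classic.
    by apply/seteqP; split => z; rewrite /A/= !in_itv/= andbT subr_ge0.
  apply: measurableI; rewrite -[X in measurable X]setTI.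
    exact: (@measurable_snd _ _ T (measurableTypeR R)).
  have : measurable_fun setT (fun z : T * measurableTypeR R => f z.1 - z.2 * c).
    apply: measurable_funB; first exact: (measurableT_comp mf).
    by apply: measurable_funM => //; exact: (@measurable_snd _ _ T (measurableTypeR R)).
  by apply.
rewrite -(tonelli_set m leb mA); apply: eq_integral => x _.
have fc0 : 0 <= f x / c by rewrite divr_ge0// ltW.
rewrite minElt; case: ifPn => h.
  transitivity (leb `]0%R, (f x / c)]%classic).
    congr (leb _); apply/seteqP; split => r; rewrite /A/= in_itv/= ler_pdivlMr//.
      by move=> [/andP[-> _] ->].
    move=> /andP[r0 rf]; split => //; rewrite r0/=.
    by apply: le_lt_trans h; rewrite ler_pdivlMr.
  by rewrite lebesgue_measure_itv/= lte_fin sube0;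
    case: ifPn => //; rewrite -leNgt => ?; congr EFin; apply/le_anti/andP.
transitivity (leb `]0%R, 1%R[%classic).
  congr (leb _); apply/seteqP; split => r; rewrite /A/= in_itv/=; first by case.
  move=> r01; split => //; move: h; rewrite -leNgt ler_pdivlMr// => h.
  apply: le_trans h; rewrite ler_pM2r//; case/andP: r01 => _; exact: ltW.
by rewrite lebesgue_measure_itv/= lte_fin ltr01 sube0.
Qed.

End layer.

Lemma measurable_set_le {R : realType} d (T : measurableType d) (f g : T -> R) :
  measurable_fun setT f -> measurable_fun setT g -> measurable [set x | f x <= g x].
Proof. by move=> mf mg; rewrite -[X in measurable X]setTI; exact: measurable_fun_le. Qed.

Lemma probability_fineK {R : realType} d (T : measurableType d) (P : probability T R)
  (A : set T) : measurable A -> (fine (P A))%:E = P A.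
Proof. by move=> mA; rewrite fineK// fin_num_measure. Qed.

Section pl1.
Context {R : realType}.
Local Notation leb := (@lebesgue_measure R).

(** Divide [f], [g] by their suprema [a], [b] and [h] by [c = sqrt (a * b)]. For [0 < r < 1] the
    level sets of [f] and [g] are then both nonempty and their sum lies in that of [h], so the
    additive inequality can be integrated over [r]. The factor 4 appears because [h] is taken at
    [x + y], not at the midpoint. *)
Lemma prekopa_leindler1 (f g h : R -> R) (If Ig Ih : R) :
  measurable_fun setT f -> measurable_fun setT g -> measurable_fun setT h ->
  (forall x, 0 <= f x <= 1) -> (forall x, 0 <= g x <= 1) -> (forall x, 0 <= h x) ->
  (forall r, 0 < r -> exists M, forall x, r <= f x -> `|x| <= M) ->
  (forall r, 0 < r -> exists M, forall x, r <= g x -> `|x| <= M) ->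
  (forall x y, f x * g y <= h (x + y) ^+ 2) ->
  (\int[leb]_x (f x)%:E = If%:E)%E -> (\int[leb]_x (g x)%:E = Ig%:E)%E ->
  (\int[leb]_x (h x)%:E = Ih%:E)%E -> 4 * (If * Ig) <= Ih ^+ 2.
Proof.
move=> mf mg mh f01 g01 h0 bf bg fgh hf hg hh.
have f0 x : 0 <= f x by case/andP: (f01 x).
have g0 x : 0 <= g x by case/andP: (g01 x).
have If0 : 0 <= If by rewrite -lee_fin -hf integral_ge0// => x _; rewrite lee_fin.
have Ig0 : 0 <= Ig by rewrite -lee_fin -hg integral_ge0// => x _; rewrite lee_fin.
have Ih0 : 0 <= Ih by rewrite -lee_fin -hh integral_ge0// => x _; rewrite lee_fin.
have trivial_case (k : R -> R) (Ik : R) : (forall x, 0 <= k x) ->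
    (\int[leb]_x (k x)%:E = Ik%:E)%E ->
    (exists x, 0 < k x) \/ Ik = 0.
  move=> k0 hk; have [?|nk] := pselect (exists x, 0 < k x); first by left.
  right; apply: EFin_inj; rewrite -hk integral0_eq// => x _; congr EFin.
  by apply/eqP; rewrite eq_le k0 andbT leNgt; apply/negP => ?; apply: nk; exists x.
have [[xf fxf]|->] := trivial_case f If f0 hf; last by rewrite mul0r mulr0 sqr_ge0.
have [[xg gxg]|->] := trivial_case g Ig g0 hg; last by rewrite !mulr0 sqr_ge0.
have sup_ok (k : R -> R) x0 : (forall x, 0 <= k x <= 1) -> 0 < k x0 ->
    [/\ 0 < sup (range k), forall x, k x <= sup (range k) &
        forall r, r < 1 -> exists x, r * sup (range k) <= k x].
  move=> k01 kx0.
  have hs : has_sup (range k).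
    split; first by exists (k x0), x0.
    by exists 1 => _ [x _ <-]; case/andP: (k01 x).
  have ub x : k x <= sup (range k) by apply: sup_upper_bound => //; exists x.
  have s0 : 0 < sup (range k) by exact: lt_le_trans (ub x0).
  split => // r r1.
  have e0 : 0 < (1 - r) * sup (range k) by rewrite mulr_gt0// subr_gt0.
  have [_ [x _ <-] hx] := sup_adherent e0 hs.
  by exists x; apply/ltW; move: hx; rewrite mulrBl mul1r opprB addrC subrK.
have [a0 fa fr] := sup_ok f xf f01 fxf.
have [b0 gb gr] := sup_ok g xg g01 gxg.
set a := sup (range f) in a0 fa fr; set b := sup (range g) in b0 gb gr.
pose c := Num.sqrt (a * b).
have c0 : 0 < c by rewrite sqrtr_gt0 mulr_gt0.
have c2 : c ^+ 2 = a * b by rewrite sqr_sqrtr// mulr_ge0// ltW.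
have lf := layer01 leb mf a0 f0.
have lg := layer01 leb mg b0 g0.
have lh := layer01 leb mh c0 h0.
have intZ (k : R -> R) (s Ik : R) : 0 < s -> measurable_fun setT k -> (forall x, 0 <= k x) ->
    (\int[leb]_x (k x)%:E = Ik%:E)%E -> (\int[leb]_x (k x / s)%:E = (Ik / s)%:E)%E.
  move=> s0 mk k0 hk.
  under eq_integral do rewrite mulrC EFinM.
  rewrite ge0_integralZl_EFin//; first by rewrite hk -EFinM mulrC.
  - by move=> x _; rewrite lee_fin.
  - exact/measurable_EFinP.
  - by rewrite invr_ge0 ltW.
have minE (k : R -> R) (s Ik : R) : 0 < s -> measurable_fun setT k -> (forall x, 0 <= k x) ->
    (forall x, k x <= s) ->
    (\int[leb]_x (k x)%:E = Ik%:E)%E -> (\int[leb]_x (Num.min (k x / s) 1)%:E = (Ik / s)%:E)%E.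
  move=> s0 mk k0 ks hk; rewrite -(intZ k s Ik s0 mk k0 hk); apply: eq_integral => x _.
  by congr EFin; apply/min_idPl; rewrite ler_pdivrMr// mul1r.
have mlev (k : R -> R) (s : R) : measurable_fun setT k -> 0 < s -> (forall x, 0 <= k x) ->
    measurable_fun setT (fun r : R => leb [set x | (0 < r < 1)%R /\ (r * s <= k x)%R]).
  move=> mk s0 k0.
  pose A := [set z : measurableTypeR R * measurableTypeR R | 0 < z.2 < 1 /\ z.2 * s <= k z.1].
  apply: (@measurable_section2 _ _ _ _ _ leb A).
  have -> : A = (snd @^-1` `]0, 1[%classic) `&` [set z | z.2 * s <= k z.1].
    by apply/seteqP; split => z; rewrite /A/= in_itv.
  apply: measurableI.
    rewrite -[X in measurable X]setTI.
    exact: (@measurable_snd _ _ (measurableTypeR R) (measurableTypeR R)).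
  apply: measurable_set_le; last exact: (measurableT_comp mk).
  by apply: measurable_funM => //; exact: (@measurable_snd _ _ (measurableTypeR R) (measurableTypeR R)).
have key : ((If / a)%:E + (Ig / b)%:E <= (Ih / c)%:E)%E.
  rewrite -(minE f a If)// -(minE g b Ig)// -lf -lg -(intZ h c Ih)//.
  rewrite -ge0_integralD//; [|exact: mlev|exact: mlev].
  apply: (@le_trans _ _ (\int[leb]_x (Num.min (h x / c) 1)%:E)%E); last first.
    apply: ge0_le_integral => //.
    - by move=> x _; rewrite lee_fin le_min ler01 andbT divr_ge0// ltW.
    - by apply/measurable_EFinP; apply: measurable_minr => //; apply: measurable_funM.
    - by apply/measurable_EFinP; apply: measurable_funM.
    - by move=> x _; rewrite lee_fin ge_min lexx.
  rewrite -lh; apply: ge0_le_integral => //.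
  - by move=> x _; rewrite adde_ge0.
  - by apply: emeasurable_funD; exact: mlev.
  - exact: mlev.
  move=> r _.
  have [r01|nr] := boolP (0 < r < 1); last first.
    have E (k : R -> R) s : [set x | is_true false /\ (r * s <= k x)%R] = set0.
      by rewrite -subset0 => x [].
    by rewrite !E !measure0 adde0.
  have E (k : R -> R) s : [set x | is_true true /\ (r * s <= k x)%R] = [set x | r * s <= k x].
    by apply/seteqP; split => [x []|x].

  rewrite !E.
  have [r0 r1] := andP r01.
  have [Mf hMf] := bf _ (mulr_gt0 r0 a0).
  have [Mg hMg] := bg _ (mulr_gt0 r0 b0).
  apply: (@brunn_minkowski1 _ _ _ _ (Num.max Mf Mg)).
  - exact: measurable_set_le.
  - exact: measurable_set_le.
  - exact: measurable_set_le.
  - exact: fr.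
  - exact: gr.
  - by move=> x /hMf; rewrite le_max => ->.
  - by move=> x /hMg; rewrite le_max orbC => ->.
  - move=> x y /= hx hy.
    have [rc ra rb] : [/\ 0 <= r * c, 0 <= r * a & 0 <= r * b].
      by split; apply/ltW/mulr_gt0.
    rewrite -(@ler_pXn2r _ 2) ?nnegrE//.
    apply: le_trans _ (fgh x y); rewrite exprMn c2.
    by apply: le_trans _ (ler_pM ra rb hx hy); rewrite expr2 mulrACA.
move: key; rewrite -EFinD lee_fin => key.
(* By [4uv <= (u + v)^2] the sum becomes a product, where the normalisations cancel since
   [c ^+ 2 = a * b]. *)
have : 4 * ((If / a) * (Ig / b)) <= (Ih / c) ^+ 2.
  have h1 : 0 <= If / a + Ig / b by rewrite addr_ge0// divr_ge0// ltW.
  apply: (@le_trans _ _ ((If / a + Ig / b) ^+ 2)).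
    by have := sqr_ge0 (If / a - Ig / b); nra.
  by rewrite ler_pXn2r// nnegrE// divr_ge0// ltW.
have -> : 4 * ((If / a) * (Ig / b)) = 4 * (If * Ig) / (a * b) by field; rewrite !gt_eqF.
by rewrite expr_div_n c2 ler_pM2r// invr_gt0 mulr_gt0.
Qed.

(* On the exponential scale [t = exp(-c s)], geometric means of levels become sums, so that the
   one-dimensional additive inequality applies to the layer-cake decomposition. *)
Lemma expR_layer_measure d (T : measurableType d) (P : probability T R) (c : R)
  (F : T -> R) : measurable_fun setT F -> 0 < c -> (forall x, 0 <= F x) ->
  (\int[P]_x (F x / c)%:E =
   \int[leb]_s (expR (- (c * s)) * fine (P [set x | (expR (- (c * s)) <= F x)%R]))%:E)%E /\
  measurable_fun setT (fun s : R => expR (- (c * s)) * fine (P [set x | (expR (- (c * s)) <= F x)%R])).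
Proof.
move=> mF c0 F0.
have me : measurable_fun setT (fun s : R => expR (- (c * s))).
  by apply: measurableT_comp => //; apply: measurableT_comp => //; apply: measurable_funM.
have me2 : measurable_fun setT (fun z : T * measurableTypeR R => expR (- (c * z.2))).
  by apply: (measurableT_comp me); exact: (@measurable_snd _ _ T (measurableTypeR R)).
pose A := [set z : T * measurableTypeR R | expR (- (c * z.2)) <= F z.1].
have mA : measurable A by apply: measurable_set_le => //; exact: (measurableT_comp mF).
have mAs s : measurable [set x | (expR (- (c * s)) <= F x)%R].
  by apply: measurable_set_le => //; exact: measurable_cst.
split; last first.
  apply: measurable_funM => //.
  apply: (measurableT_comp (fine_measurable _)) => //.
  exact: (measurable_section2 P mA).
pose f (z : T * measurableTypeR R) := (expR (- (c * z.2)) * \1_A z)%:E.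
have mf : measurable_fun setT f.
  by apply/measurable_EFinP; apply: measurable_funM => //; exact: measurable_indic.
have f0 z : (0 <= f z)%E by rewrite lee_fin mulr_ge0// expR_ge0.
transitivity (\int[P]_x \int[leb]_s f (x, s))%E.
  apply: eq_integral => x _; rewrite -expR_layer//; apply: eq_integral => s _.
  by rewrite /f indicE mem_setE.
rewrite fubini_tonelli//; apply: eq_integral => s _.
rewrite /f; under eq_integral do rewrite EFinM/=.
rewrite ge0_integralZl_EFin ?expR_ge0//; last first.
  by apply/measurable_EFinP; apply: measurableT_comp => //; exact: measurable_indic.
rewrite EFinM probability_fineK//; congr *%E.
rewrite -[X in P X]setIT -integral_indic//.
Qed.

End pl1.

Section pl.
Context {R : realType}.
Local Notation leb := (@lebesgue_measure R).

Lemma compact_mink n l (A B : set (Rn R n)) :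
  compact (@vecn R n @` A) -> compact (@vecn R n @` B) ->
  measurable (mink_comb l A B).
Proof.
move=> cA cB.
pose s (z : 'rV[R]_n * 'rV[R]_n) := l *: z.1 + (1 - l) *: z.2.
have cs : continuous s.
  move=> z; apply: (@cvgD _ _ _ (nbhs z)); apply: (@cvgZr _ _ _ (nbhs z)).
    exact: cvg_fst.
  exact: cvg_snd.
have cC : compact (s @` ((@vecn R n @` A) `*` (@vecn R n @` B))).
  apply: continuous_compact; last exact: compact_setX.
  exact: continuous_subspaceT.
have := measurable_closed_vecn (compact_closed (@norm_hausdorff _ _) cC).
congr measurable; apply/seteqP; split => x /=.
  by move=> [[p q] /= [[a Aa <-] [b Bb <-]] e]; exists a, b; rewrite -e.
by move=> [a [b [Aa [Bb ->]]]]; exists (vecn a, vecn b) => //; split; [exists a|exists b].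
Qed.

(** Squaring the midpoint case turns the powers [2^-1] into a plain product, the form that is
    propagated from sets to functions and then to sums. *)
Lemma log_concave_mid n (mu : probability (Rn R n) R) (A B : set (Rn R n)) :
  log_concave mu -> compact (@vecn R n @` A) -> compact (@vecn R n @` B) ->
  fine (mu A) * fine (mu B) <= fine (mu (mink_comb 2^-1 A B)) ^+ 2.
Proof.
move=> [lc _] cA cB.
have h01 : 0 < (2^-1 : R) < 1 by rewrite invr_gt0 ltr0n/= invf_lt1// ltr1n.
have := lc A B _ cA cB h01.
have -> : 1 - 2^-1 = 2^-1 :> R by lra.
rewrite !powR12_sqrt ?fine_ge0// => h.
rewrite -(@ler_pXn2r _ 2) ?nnegrE ?mulr_ge0 ?sqrtr_ge0 ?fine_ge0// in h.
by rewrite exprMn !sqr_sqrtr ?fine_ge0 in h.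
Qed.

(** [F] and [G] are layered with rate 1 and [H] with rate [2^-1]: the threshold of [H] at [x + y] is
    then the geometric mean of those of [F] at [x] and [G] at [y], and [log_concave_mid] compares
    the level sets. The layers of [H] integrate to [2 * Ih], which absorbs the factor 4. *)
Lemma prekopa_leindler n (mu : probability (Rn R n) R) (F G H : 'rV[R]_n -> R) (If Ig Ih : R) :
  log_concave mu ->
  measurable_fun setT (F \o @vecn R n) -> measurable_fun setT (G \o @vecn R n) ->
  measurable_fun setT (H \o @vecn R n) ->
  (forall x, 0 <= F x <= 1) -> (forall x, 0 <= G x <= 1) -> (forall x, 0 <= H x) ->
  (forall r, 0 < r -> compact [set v | r <= F v]) ->
  (forall r, 0 < r -> compact [set v | r <= G v]) ->
  (forall y z, F y * G z <= H (2^-1 *: (y + z)) ^+ 2) ->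
  (\int[mu]_x (F (vecn x))%:E = If%:E)%E -> (\int[mu]_x (G (vecn x))%:E = Ig%:E)%E ->
  (\int[mu]_x (H (vecn x))%:E = Ih%:E)%E -> If * Ig <= Ih ^+ 2.
Proof.
move=> lc mF mG mH F01 G01 H0 cF cG FGH hF hG hH.
have F0 x : 0 <= (F \o @vecn R n) x by case/andP: (F01 (vecn x)).
have G0 x : 0 <= (G \o @vecn R n) x by case/andP: (G01 (vecn x)).
have H0' x : 0 <= (H \o @vecn R n) x by exact: H0.
pose lay c (K : 'rV[R]_n -> R) (s : R) : R :=
  expR (- (c * s)) * fine (mu [set x | expR (- (c * s)) <= K (vecn x)]).
have [eF mf] := expR_layer_measure mu mF ltr01 F0.
have [eG mg] := expR_layer_measure mu mG ltr01 G0.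
have h20 : 0 < (2^-1 : R) by rewrite invr_gt0.
have [eH mh] := expR_layer_measure mu mH h20 H0'.
rewrite -/(lay 1 F) in mf; rewrite -/(lay 1 G) in mg; rewrite -/(lay 2^-1 H) in mh.
have mlev (K : 'rV[R]_n -> R) (r : R) : measurable_fun setT (K \o @vecn R n) ->
    measurable [set x : Rn R n | r <= K (vecn x)].
  by move=> mK; apply: measurable_set_le => //; exact: measurable_cst.
(* For [x < 0] the threshold exceeds 1, so [K <= 1] empties the level set; for large [x] the factor
   [expR (- x)] decays. This gives the bounded superlevel sets demanded in dimension one. *)
have prop (K : 'rV[R]_n -> R) (mK : measurable_fun setT (K \o @vecn R n)) :
    (forall x, 0 <= K x <= 1) ->
    let k := lay 1 K in
    (forall x, 0 <= k x <= 1) /\ (forall r, 0 < r -> exists M, forall x, r <= k x -> `|x| <= M).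
  move=> K01 k.
  have k0 x : 0 <= k x by rewrite mulr_ge0 ?expR_ge0 ?fine_ge0.
  have m1 (A : set (Rn R n)) : measurable A -> fine (mu A) <= 1.
    by move=> mA; rewrite -lee_fin probability_fineK// probability_le1.
  have kE x : k x != 0 -> 0 <= x.
    move=> kx; rewrite leNgt; apply/negP => x0; move/negP: kx; apply.
    rewrite /k /lay (_ : [set _ | _] = set0) ?measure0 ?mulr0//.
    rewrite -subset0 => y /=; have /andP[_ K1] := K01 (vecn y).
    move=> /le_trans /(_ K1); rewrite mul1r -expR0 ler_expR; lra.
  have ke x : k x <= expR (- x).
    by rewrite /k /lay mul1r ler_piMr ?expR_ge0// m1//; exact: mlev.
  split => [x|r r0].
    rewrite k0/=; have [->//|/kE x0] := eqVneq (k x) 0.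
    by apply: le_trans (ke x) _; rewrite -expR0 ler_expR; lra.
  exists (- ln r) => x rk.
  have x0 : 0 <= x by apply: kE; rewrite gt_eqF//; exact: lt_le_trans rk.
  rewrite ger0_norm// lerNr -ler_expR lnK//.
  exact: le_trans (ke x).
have [f01 bf] := prop F mF F01.
have [g01 bg] := prop G mG G01.
have Ihh : (\int[leb]_s (lay 2^-1 H s)%:E = (2 * Ih)%:E)%E.
  rewrite -eH; under eq_integral do rewrite invrK mulrC EFinM.
  rewrite ge0_integralZl_EFin//; first by rewrite hH -EFinM.
    by move=> x _; rewrite lee_fin.
  exact/measurable_EFinP.
have Iff : (\int[leb]_s (lay 1 F s)%:E = If%:E)%E.
  by rewrite -eF -hF; apply: eq_integral => x _; rewrite divr1.
have Igg : (\int[leb]_s (lay 1 G s)%:E = Ig%:E)%E.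
  by rewrite -eG -hG; apply: eq_integral => x _; rewrite divr1.
have h0 x : 0 <= lay 2^-1 H x by rewrite mulr_ge0 ?expR_ge0 ?fine_ge0.
have := prekopa_leindler1 mf mg mh f01 g01 h0 bf bg _ Iff Igg Ihh.
rewrite exprMn -natrX ler_pM2l ?ltr0n//; apply.
move=> x y; rewrite /lay exprMn.
have -> : expR (- (2^-1 * (x + y))) ^+ 2 = expR (- (1 * x)) * expR (- (1 * y)).
  by rewrite -expRM_natl -expRD; congr expR; lra.
rewrite mulrACA ler_pM2l ?mulr_gt0 ?expR_gt0//.
pose A := [set u | expR (- (1 * x)) <= F (@vecn R n u)].
pose B := [set u | expR (- (1 * y)) <= G (@vecn R n u)].
have cA : compact (@vecn R n @` A).
  by apply: (@compact_vecn _ _ [set v | expR (- (1 * x)) <= F v]); apply: cF; exact: expR_gt0.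
have cB : compact (@vecn R n @` B).
  by apply: (@compact_vecn _ _ [set v | expR (- (1 * y)) <= G v]); apply: cG; exact: expR_gt0.
apply: le_trans (log_concave_mid lc cA cB) _.
have mM := compact_mink 2^-1 cA cB.
rewrite ler_pXn2r ?nnegrE ?fine_ge0//.
apply: fine_le.
- exact: fin_num_measure.
- by apply: fin_num_measure; exact: mlev.
apply: le_measure; rewrite ?inE//; first exact: mlev.
move=> u [a [b [/= Aa [Bb e]]]] /=.
have -> : vecn u = 2^-1 *: (vecn a + vecn b).
  by rewrite e scalerDr; congr (_ + _ *: _); lra.
rewrite -(@ler_pXn2r _ 2) ?nnegrE ?expR_ge0//.
apply: le_trans (FGH (vecn a) (vecn b)).
have -> : expR (- (2^-1 * (x + y))) ^+ 2 = expR (- (1 * x)) * expR (- (1 * y)).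
  by rewrite -expRM_natl -expRD; congr expR; lra.
by apply: ler_pM; rewrite ?expR_ge0.
Qed.
End pl.

(** * Prekopa-Leindler for unbounded functions with closed superlevel sets *)

Section plext.
Context {R : realType}.

Lemma measurable_norm_mvec d (T : measurableType d) n (X : T -> 'rV[R]_n) :
  mvec X -> measurable_fun setT (fun t => `|X t|).
Proof.
move=> mX; move=> mT; apply: (measurability _ (RGenOInfty.measurableE R)) => // _ [_ [r ->] <-].
rewrite setTI.
have := measurable_closed_mvec mX (@closed_rV_ball R n 0 r).
move=> /measurableC; congr measurable; apply/seteqP; split => t /=.
  by move/negP; rewrite -ltNge subr0 in_itv/= andbT.
by rewrite in_itv/= andbT subr0 => h; apply/negP; rewrite -ltNge.
Qed.

Lemma closed_norm_ge n (r : R) : closed [set v : 'rV[R]_n | r <= `|v|].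
Proof.
apply/closed_rVP => v /= /negP; rewrite -ltNge => h.
exists (r - `|v|); first by rewrite subr_gt0.
move=> w; have := ler_normB w (w - v); rewrite subKr.
have := ler_normD (w - v) v; rewrite subrK.
by move=> h1 h2 h3; apply/negP; rewrite -ltNge; lra.
Qed.

(** Cutting the height allows rescaling into [[0, 1]], cutting the support makes closed superlevel
    sets compact, and the result increases to [F] with [k]. *)
Definition trunc n (k : nat) (F : 'rV[R]_n -> R) (v : 'rV[R]_n) :=
  Num.min (F v) k.+1%:R * (`|v| <= k.+1%:R)%R%:R.

Lemma trunc_compact n k (F : 'rV[R]_n -> R) r :
  (forall r, 0 < r -> closed [set v | r <= F v]) -> 0 < r ->
  compact [set v | r <= trunc k F v].
Proof.
move=> cF r0.
have E : [set v | r <= trunc k F v] =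
    if r <= k.+1%:R then [set v | r <= F v] `&` [set v | `|v - 0| <= k.+1%:R] else set0.
  apply/seteqP; split => v /=.
    rewrite /trunc; case: (boolP (`|v| <= k.+1%:R)) => h; rewrite ?mulr1 ?mulr0.
      by rewrite le_min => /andP[h1 ->]; split => //=; rewrite subr0.
    by rewrite leNgt r0.
  case: ifP => // rk; rewrite /= subr0 => -[h1 h2]; rewrite /trunc h2 mulr1 le_min.
  by rewrite h1.
rewrite E; case: ifP => _; last exact: compact0.
apply: bounded_closed_compact.
  exists k.+1%:R; split => // M /ltW kM v [_ /=]; rewrite subr0 => /le_trans; exact.
by apply: closedI; [exact: cF|exact: closed_rV_ball].
Qed.

Lemma measurable_trunc n k (F : 'rV[R]_n -> R) :
  measurable_fun setT (F \o @vecn R n) -> measurable_fun setT (trunc k F \o @vecn R n).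
Proof.
move=> mF.
have -> : trunc k F \o @vecn R n = (fun x => Num.min (F (vecn x)) k.+1%:R *
    \1_(@vecn R n @^-1` [set v | `|v - 0| <= k.+1%:R]) x).
  apply/funext => x /=; rewrite /trunc indicE; congr (_ * (nat_of_bool _)%:R).
  by apply/idP/idP; rewrite inE/= subr0.
apply: measurable_funM; first exact: measurable_minr.
by apply: measurable_indic; apply: measurable_closed_vecn; exact: closed_rV_ball.
Qed.

Lemma trunc_ge0 n k (F : 'rV[R]_n -> R) v : (forall v, 0 <= F v) -> 0 <= trunc k F v.
Proof. by move=> F0; rewrite mulr_ge0// le_min F0 ler0n. Qed.

Lemma trunc_le n k (F : 'rV[R]_n -> R) v : (forall v, 0 <= F v) -> trunc k F v <= F v.
Proof.
by move=> F0; rewrite /trunc; case: (`|_| <= _); rewrite ?mulr1 ?mulr0// ge_min lexx.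
Qed.

Lemma trunc_cvg n (mu : probability (Rn R n) R) (F : 'rV[R]_n -> R) :
  measurable_fun setT (F \o @vecn R n) -> (forall v, 0 <= F v) ->
  (\int[mu]_x (trunc k F (vecn x))%:E @[k --> \oo] --> \int[mu]_x (F (vecn x))%:E)%E.
Proof.
move=> mF F0.
have tlim x : limn (fun k => (trunc k F (@vecn R n x))%:E) = (F (vecn x))%:E.
  apply/cvg_lim => //; apply: cvg_near_cst.
  near=> k; congr EFin; rewrite /trunc.
  have h1 : F (vecn x) <= k.+1%:R
    by apply: (@le_trans _ _ k%:R); [near: k; exact: nbhs_infty_ger|rewrite ler_nat].
  have h2 : `|vecn x| <= k.+1%:R
    by apply: (@le_trans _ _ k%:R); [near: k; exact: nbhs_infty_ger|rewrite ler_nat].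
  by rewrite h2 mulr1; apply/min_idPl.
under [X in _ --> X]eq_integral do rewrite -tlim.
apply: cvg_monotone_convergence => //.
- by move=> k; apply/measurable_EFinP; exact: measurable_trunc.
- by move=> k x _; rewrite lee_fin trunc_ge0.
- move=> x _ k m km; rewrite lee_fin /trunc.
  have km' : k.+1%:R <= m.+1%:R :> R by rewrite ler_nat.
  apply: ler_pM => //; first by rewrite le_min F0 ler0n.
    by rewrite le_min ge_min lexx/= ge_min km' orbT.
  by case: (boolP (`|_| <= k.+1%:R)) => // /le_trans ->.
Unshelve. all: by end_near. Qed.

(** Truncate [F] and [G], apply the compact case, and pass to the limit by monotone convergence. The
    integral of [F] is left in the extended reals so that the inequality can prove it finite. *)
Lemma prekopa_leindler_closed n (mu : probability (Rn R n) R) (F G H : 'rV[R]_n -> R)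
  (Ig Ih : R) :
  log_concave mu ->
  measurable_fun setT (F \o @vecn R n) -> measurable_fun setT (G \o @vecn R n) ->
  measurable_fun setT (H \o @vecn R n) ->
  (forall x, 0 <= F x) -> (forall x, 0 <= G x) -> (forall x, 0 <= H x) ->
  (forall r, 0 < r -> closed [set v | r <= F v]) ->
  (forall r, 0 < r -> closed [set v | r <= G v]) ->
  (forall y z, F y * G z <= H (2^-1 *: (y + z)) ^+ 2) ->
  (\int[mu]_x (G (vecn x))%:E = Ig%:E)%E ->
  (\int[mu]_x (H (vecn x))%:E = Ih%:E)%E ->
  (\int[mu]_x (F (vecn x))%:E * Ig%:E <= (Ih ^+ 2)%:E)%E.
Proof.
move=> lc mF mG mH F0 G0 H0 cF cG FGH hG hH.
have tfin (K : 'rV[R]_n -> R) k : measurable_fun setT (K \o @vecn R n) ->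
    (forall v, 0 <= K v) ->
    exists2 I : R, 0 <= I & (\int[mu]_x (trunc k K (vecn x))%:E = I%:E)%E.
  move=> mK K0.
  have h0 : (0 <= \int[mu]_x (trunc k K (vecn x))%:E)%E.
    by apply: integral_ge0 => x _; rewrite lee_fin trunc_ge0.
  exists (fine (\int[mu]_x (trunc k K (vecn x))%:E)); first exact: fine_ge0.
  rewrite fineK// ge0_fin_numE//.
  apply: (@le_lt_trans _ _ (\int[mu]_x (k.+1%:R)%:E)%E).
    apply: ge0_le_integral => //.
    - by move=> x _; rewrite lee_fin trunc_ge0.
    - by apply/measurable_EFinP; exact: measurable_trunc.
    - move=> x _; rewrite lee_fin /trunc.
      by case: (`|_| <= _); rewrite ?mulr1 ?mulr0// ge_min lexx orbT.
  rewrite integral_cst//= [X in (_ * X)%E](_ : _ = 1%E) ?mule1 ?ltry//.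
  exact: probability_setT.
have main k m If' Ig' : (\int[mu]_x (trunc k F (vecn x))%:E = If'%:E)%E ->
    (\int[mu]_x (trunc m G (vecn x))%:E = Ig'%:E)%E -> If' * Ig' <= Ih ^+ 2.
  move=> hF hG'.
  have scale (K : 'rV[R]_n -> R) (I c : R) : 0 < c -> (forall v, 0 <= K v) ->
      measurable_fun setT (K \o @vecn R n) ->
      (\int[mu]_x (K (vecn x))%:E = I%:E -> \int[mu]_x (K (vecn x) / c)%:E = (I / c)%:E)%E.
    move=> c0 K0 mK hK; under eq_integral do rewrite mulrC EFinM.
    rewrite ge0_integralZl_EFin//; first by rewrite hK -EFinM mulrC.
    - by move=> x _; rewrite lee_fin.
    - exact/measurable_EFinP.
    - by rewrite invr_ge0 ltW.
  have k0 : 0 < k.+1%:R :> R by [].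
  have m0 : 0 < m.+1%:R :> R by [].
  (* The geometric mean of the two heights: dividing [H] by it matches dividing [F] and [G] by their
     heights. *)
  pose c : R := Num.sqrt (k.+1%:R * m.+1%:R).
  have c0 : 0 < c by rewrite sqrtr_gt0 mulr_gt0.
  have c2 : c ^+ 2 = k.+1%:R * m.+1%:R by rewrite sqr_sqrtr// mulr_ge0// ltW.
  have t01 (K : 'rV[R]_n -> R) j v : (forall v, 0 <= K v) -> 0 <= trunc j K v / j.+1%:R <= 1.
    move=> K0; rewrite divr_ge0 ?trunc_ge0//= ler_pdivrMr// mul1r /trunc.
    by case: (`|_| <= _); rewrite ?mulr1 ?mulr0// ge_min lexx orbT.
  have tc (K : 'rV[R]_n -> R) j r : (forall r, 0 < r -> closed [set v | r <= K v]) -> 0 < r ->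
      compact [set v | r <= trunc j K v / j.+1%:R].
    move=> cK r0; have := @trunc_compact _ j K (r * j.+1%:R) cK (mulr_gt0 r0 (ltr0Sn _ _)).
    by congr compact; apply/seteqP; split => v /=; rewrite ler_pdivlMr.
  have := @prekopa_leindler _ _ mu (fun v => trunc k F v / k.+1%:R)
    (fun v => trunc m G v / m.+1%:R) (fun v => H v / c) _ _ _ lc
    _ _ _ (fun v => t01 F k v F0) (fun v => t01 G m v G0) _ (fun r => tc F k r cF)
    (fun r => tc G m r cG) _
    (scale _ _ _ k0 _ _ hF) (scale _ _ _ m0 _ _ hG') (scale _ _ _ c0 H0 mH hH).
  rewrite expr_div_n c2 mulrACA -invfM ler_pM2r ?invr_gt0 ?mulr_gt0//; apply.
  - by apply: measurable_funM => //; exact: measurable_trunc.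
  - by apply: measurable_funM => //; exact: measurable_trunc.
  - by apply: measurable_funM.
  - by move=> v; rewrite divr_ge0// ltW.
  - move=> y z; rewrite expr_div_n c2 mulrACA -invfM ler_pM2r ?invr_gt0 ?mulr_gt0//.
    by apply: le_trans (FGH y z); apply: ler_pM; rewrite ?trunc_ge0 ?trunc_le.
  - by move=> v; exact: trunc_ge0.
  - exact: measurable_trunc.
  - by move=> v; exact: trunc_ge0.
  - exact: measurable_trunc.
have step k If' : (\int[mu]_x (trunc k F (vecn x))%:E = If'%:E)%E -> 0 <= If' ->
    If' * Ig <= Ih ^+ 2.
  move=> hF If0; rewrite -lee_fin EFinM -hG.
  have : (If'%:E * (\int[mu]_x (trunc m G (vecn x))%:E) @[m --> \oo] -->
          If'%:E * \int[mu]_x (G (vecn x))%:E)%E.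
    by apply: cvgeZl => //; exact: trunc_cvg.
  move/cvg_lim => <-//; apply: lime_le.
    by apply/cvg_ex; eexists; apply: cvgeZl => //; exact: trunc_cvg.
  apply: nearW => m; have [I _ hI] := tfin G m mG G0; rewrite hI -EFinM lee_fin.
  exact: main hF hI.
have cv : ((\int[mu]_x (trunc k F (vecn x))%:E) * Ig%:E @[k --> \oo] -->
          \int[mu]_x (F (vecn x))%:E * Ig%:E)%E.
  by apply: cvgeZr => //; exact: trunc_cvg.
rewrite -(cvg_lim _ cv)//; apply: lime_le; first by apply/cvg_ex; eexists; exact: cv.
apply: nearW => k; have [I I0 hI] := tfin F k mF F0; rewrite hI -EFinM lee_fin.
exact: step hI I0.
Qed.

End plext.

(** * Second moments *)

Section moments.
Context {R : realType}.

Lemma probability_integral_gt0 d (T : measurableType d) (P : probability T R) (f : T -> R) :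
  measurable_fun setT f -> (forall x, 0 < f x) -> (0 < \int[P]_x (f x)%:E)%E.
Proof.
move=> mf f0; rewrite lt_def integral_ge0 ?andbT; last by move=> x _; rewrite lee_fin ltW.
apply/eqP => h.
have : (\int[P]_x `|(f x)%:E| = 0)%E.
  by rewrite -h; apply: eq_integral => x _; rewrite gee0_abs// lee_fin ltW.
have mf' : measurable_fun setT (fun x => (f x)%:E) by exact/measurable_EFinP.
move=> /(ae_eq_integral_abs P measurableT mf').
move=> [N [mN N0 sN]].
have : (P setT <= P N)%E.
  apply: le_measure; rewrite ?inE// => x _; apply: sN => /= /(_ I) /eqP.
  by rewrite eqe gt_eqF.
by rewrite N0 [X in (X <= _)%E -> _](_ : _ = 1%E) ?probability_setT// leNgt lte01.
Qed.

Lemma centered_norm_integrable n (mu : probability (Rn R n) R) : centered mu ->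
  mu.-integrable setT (fun x => `|vecn x|%:E).
Proof.
move=> c.
apply: (@le_integrable _ _ _ _ _ measurableT _ (fun x => (\sum_(i < n) `|(vecn x 0 i)%:E|)%E)).
- by apply/measurable_EFinP; apply: measurable_norm_mvec; exact: mvec_vecn.
- move=> x _; rewrite [leRHS]gee0_abs; last by apply: sume_ge0.
  rewrite /= normr_id sumEFin lee_fin; apply/rV_norm_le; first exact: sumr_ge0.
  by move=> i; rewrite (bigD1 i)//= lerDl sumr_ge0.
- apply: integrable_sum => // i _; apply: integrable_abse.
  by case: (c i).
Qed.

(* Prekopa-Leindler for [F = |y|^2/4], [G = exp(-2|z|)] and [H = 1 + |w|] bounds the second
   moment by the square of the first, which is finite because [mu] is centered. *)
Lemma log_concave_norm2 n (mu : probability (Rn R n) R) : log_concave mu -> centered mu ->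
  (\int[mu]_x (`|vecn x| ^+ 2)%:E < +oo)%E.
Proof.
move=> lc c.
pose F (v : 'rV[R]_n) := (`|v| / 2) ^+ 2.
pose G (v : 'rV[R]_n) := expR (- `|v|) ^+ 2.
pose H (v : 'rV[R]_n) := 1 + `|v|.
have mn := measurable_norm_mvec (@mvec_vecn R n).
have H1 v : 1 <= H v by rewrite /H lerDl.
have H0 v : 0 < H v by exact: lt_le_trans (H1 v).
have mH : measurable_fun setT (H \o @vecn R n) by exact: measurable_funD.
have mG : measurable_fun setT (G \o @vecn R n).
  by apply: measurable_funX; apply: measurableT_comp => //; apply: measurableT_comp.
have mF : measurable_fun setT (F \o @vecn R n).
  by apply: measurable_funX; exact: measurable_funM.
have F0 v : 0 <= F v by exact: sqr_ge0.
have G0 v : 0 < G v by rewrite exprn_gt0// expR_gt0.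
have iH : mu.-integrable setT (fun x => (H (vecn x))%:E).
  apply: (@integrableD _ _ _ mu setT measurableT (fun=> 1%E) (fun x => `|vecn x|%:E)).
    exact: finite_measure_integrable_cst.
  exact: centered_norm_integrable.
have [Ih hH] : exists Ih : R, (\int[mu]_x (H (vecn x))%:E = Ih%:E)%E.
  by exists (fine (\int[mu]_x (H (vecn x))%:E)%E); rewrite fineK//; apply: integrable_fin_num.
have [Ig hG] : exists Ig : R, (\int[mu]_x (G (vecn x))%:E = Ig%:E)%E.
  exists (fine (\int[mu]_x (G (vecn x))%:E)%E); rewrite fineK//.
  apply: integrable_fin_num => //.
  apply: le_integrable iH => //; first exact/measurable_EFinP.
  move=> x _; rewrite !gee0_abs ?lee_fin ?(ltW (G0 _)) ?(ltW (H0 _))//.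
  by apply: le_trans (H1 _); rewrite exprn_ile1 ?expR_ge0// -expR0 ler_expR oppr_le0.
have Ig0 : 0 < Ig.
  by rewrite -lte_fin -hG; apply: probability_integral_gt0 => // x.
have := prekopa_leindler_closed lc mF mG mH F0 (fun v => ltW (G0 v)) (fun v => ltW (H0 v))
  _ _ _ hG hH.
have cF r : 0 < r -> closed [set v | r <= F v].
  move=> r0; have := @closed_norm_ge R n (2 * Num.sqrt r); congr closed.
  apply/funext => v /=; apply/propext; rewrite -/(is_true (r <= F v)).
  have -> : (r <= F v) = (Num.sqrt r ^+ 2 <= (`|v| / 2) ^+ 2) by rewrite sqr_sqrtr//; exact: ltW.
  by rewrite ler_pXn2r ?nnegrE ?divr_ge0 ?sqrtr_ge0//; split; lra.
have cG r : 0 < r -> closed [set v | r <= G v].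
  move=> r0; have := @closed_rV_ball R n 0 (- ln (Num.sqrt r)); congr closed.
  have s0 : 0 < Num.sqrt r by rewrite sqrtr_gt0.
  apply/funext => v /=; apply/propext; rewrite subr0.
  have -> : (r <= G v) = (Num.sqrt r ^+ 2 <= expR (- `|v|) ^+ 2) by rewrite sqr_sqrtr//; exact: ltW.
  rewrite ler_pXn2r ?nnegrE ?expR_ge0 ?sqrtr_ge0//.
  have -> : (Num.sqrt r <= expR (- `|v|)) = (expR (ln (Num.sqrt r)) <= expR (- `|v|)) by rewrite lnK.
  by rewrite ler_expR; split; lra.
(* After taking roots the claim is [|y| / 2 <= (1 + |y + z| / 2) * expR |z|], which follows from
   [|y| <= |y + z| + |z|] and [1 + |z| <= expR |z|]. *)
have FGH y z : F y * G z <= H (2^-1 *: (y + z)) ^+ 2.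
  rewrite -exprMn ler_pXn2r ?nnegrE ?(ltW (H0 _)) ?mulr_ge0 ?expR_ge0//.
  rewrite expRN ler_pdivrMr ?expR_gt0// /H normrZ ger0_norm ?invr_ge0//.
  have : `|y| <= `|y + z| + `|z|.
    by rewrite -{1}(addrK z y) (le_trans (ler_normB _ _)).
  have := normr_ge0 z; have := normr_ge0 (y + z); have := expR_ge1Dx `|z|; nra.
move=> /(_ cF cG FGH); case E : (\int[mu]_x (F (vecn x))%:E)%E => [r| |] h.
- rewrite (_ : (\int[mu]_x (`|vecn x| ^+ 2)%:E)%E = (4%:E * r%:E)%E) ?ltry// -E.
  rewrite -ge0_integralZl_EFin//.
  + by apply: eq_integral => x _; rewrite -EFinM; congr EFin; rewrite /F; lra.
  + by move=> x _; rewrite lee_fin.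
  + exact/measurable_EFinP.
- by move: h; rewrite gt0_mulye ?lte_fin// leye_eq.
- have : (0 <= \int[mu]_x (F (vecn x))%:E)%E by apply: integral_ge0 => x _; rewrite lee_fin.
  by rewrite E.
Qed.

Lemma log_concave_integrable2 n (mu : probability (Rn R n) R) i j :
  log_concave mu -> centered mu ->
  mu.-integrable setT (fun x => (vecn x 0 i * vecn x 0 j)%:E).
Proof.
move=> lc c.
have mn := measurable_norm_mvec (@mvec_vecn R n).
apply: (@le_integrable _ _ _ _ _ measurableT _ (fun x => (`|vecn x| ^+ 2)%:E)).
- by apply/measurable_EFinP; apply: measurable_funM; exact: mvec_vecn.
- move=> x _; rewrite !abse_EFin lee_fin normrM [leRHS]ger0_norm ?sqr_ge0// expr2.
  by apply: ler_pM => //; exact: rV_coord_le.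
- apply/integrableP; split; first by apply/measurable_EFinP; exact: measurable_funX.
  apply: le_lt_trans (log_concave_norm2 lc c); rewrite le_eqVlt; apply/orP; left; apply/eqP.
  by apply: eq_integral => x _; rewrite gee0_abs// lee_fin sqr_ge0.
Qed.

End moments.

(** * Sums of independent points *)

Section sums.
Context {R : realType} {n : nat} (mu : probability (Rn R n) R).

Definition sample (k : nat) : measurableType _ := sf_type (pow_sfspace (prob_sfspace mu) k).

Fixpoint sample_sum (k : nat) : sample k -> 'rV[R]_n :=
  match k return sample k -> 'rV[R]_n with
  | 0 => fun=> 0
  | k'.+1 => fun w => vecn w.1 + @sample_sum k' w.2
  end.

Lemma prod_powS k (A : set (sample k.+1)) :
  (prod_pow mu k.+1 A = \int[mu]_y prod_pow mu k [set w | A (y, w)])%E.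
Proof.
transitivity (\int[mu]_y (prod_pow mu k \o xsection A) y)%E => //.
by apply: eq_integral => y _ /=; rewrite xsectionE.
Qed.

Lemma prod_pow_setT k : prod_pow mu k setT = 1%E.
Proof.
elim: k => [|k IH]; first by rewrite /prod_pow/= diracT.
rewrite prod_powS (_ : (fun y => _) = cst 1%E); last by apply/funext => y; exact: IH.
by rewrite integral_cst// mul1e; exact: probability_setT.
Qed.

Lemma prod_pow_le1 k A : measurable A -> (prod_pow mu k A <= 1)%E.
Proof. by move=> mA; rewrite -(prod_pow_setT k); apply: le_measure; rewrite ?inE. Qed.

Lemma prod_pow_fineK k A : measurable A -> ((fine (prod_pow mu k A))%:E = prod_pow mu k A)%E.
Proof.
by move=> mA; rewrite fineK// ge0_fin_numE// (le_lt_trans (prod_pow_le1 mA))// ltry.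
Qed.

Lemma integral_prod_powS k (G : sample k.+1 -> \bar R) : measurable_fun setT G ->
  (forall w, 0 <= G w)%E ->
  (\int[prod_pow mu k.+1]_w G w = \int[mu]_y \int[prod_pow mu k]_w G (y, w))%E.
Proof. by move=> mG G0; exact: (fubini_tonelli1 G mG G0). Qed.

Lemma measurable_hd k : measurable_fun setT (fun w : sample k.+1 => w.1 : Rn R n).
Proof. exact: (@measurable_fst _ _ (Rn R n) (sample k)). Qed.

Lemma measurable_tl k : measurable_fun setT (fun w : sample k.+1 => w.2 : sample k).
Proof. exact: (@measurable_snd _ _ (Rn R n) (sample k)). Qed.

Lemma mvec_sample_sum k : mvec (@sample_sum k).
Proof.
elim: k => [|k IH] /=; first exact: mvec_cst.
apply: mvecD.
  exact: (mvec_comp (@mvec_vecn R n) (@measurable_hd k)).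
exact: (mvec_comp IH (@measurable_tl k)).
Qed.

(** The function [Phi] of the overview. The norm being the sup norm, this is the mass of a cube of
    side [2 * e], so up to the factor [(2 * e) ^+ n] a density of the sum smoothed at scale [e]. *)
Definition sum_box (k : nat) (e : R) (a : 'rV[R]_n) : R :=
  fine (prod_pow mu k [set w | `|sample_sum w - a| <= e]).

Lemma measurable_sum_box_pair d (T : measurableType d) k e (X : T -> 'rV[R]_n) : mvec X ->
  measurable [set z : sample k * T | `|sample_sum z.1 - X z.2| <= e].
Proof.
move=> mX; apply: measurable_set_le; last exact: measurable_cst.
apply: measurable_norm_mvec; apply: mvecB.
  by apply: (mvec_comp (@mvec_sample_sum k)); exact: measurable_fst.
by apply: (mvec_comp mX); exact: measurable_snd.
Qed.

Lemma measurable_sum_box_set k e a : measurable [set w : sample k | `|sample_sum w - a| <= e].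
Proof.
exact: (measurable_closed_mvec (@mvec_sample_sum k) (@closed_rV_ball R n a e)).
Qed.

Lemma sum_boxE k e a : (sum_box k e a)%:E = prod_pow mu k [set w | `|sample_sum w - a| <= e].
Proof. by rewrite prod_pow_fineK//; exact: measurable_sum_box_set. Qed.

Lemma sum_box_ge0 k e a : 0 <= sum_box k e a.
Proof. exact: fine_ge0. Qed.

Lemma measurable_sum_box k e : measurable_fun setT (sum_box k e \o @vecn R n).
Proof.
apply: (measurableT_comp (fine_measurable _)) => //.
have mA := @measurable_sum_box_pair _ _ k e _ (@mvec_vecn R n).
exact: (measurable_section2 (prod_pow mu k) mA).
Qed.

Lemma sum_boxS k e a :
  (sum_box k.+1 e a)%:E = (\int[mu]_y (sum_box k e (a - vecn y))%:E)%E.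
Proof.
rewrite sum_boxE prod_powS; apply: eq_integral => y _.
rewrite sum_boxE; congr (prod_pow mu k _); apply/seteqP; split => w /=;
  by rewrite opprB addrCA addrA.
Qed.

(** Upper semicontinuity: the closed box is the decreasing intersection of the boxes enlarged by
    [1/(j+1)], and a box at a centre that close to [a] lies inside the enlarged one. *)
Lemma closed_sum_box k e r : 0 <= e -> closed [set a | r <= sum_box k e a].
Proof.
move=> e0; apply/closed_rVP => a /= /negP; rewrite -ltNge => h.
pose A j := [set w : sample k | `|sample_sum w - a| <= e + j.+1%:R^-1].
have mA j : measurable (A j) by exact: measurable_sum_box_set.
have IA : \bigcap_j A j = [set w | `|sample_sum w - a| <= e].
  apply/seteqP; split => w /=; last first.
    by move=> h' j _; apply: le_trans h' _; rewrite lerDl invr_ge0.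
  move=> h'; apply/ler_addgt0Pr => d d0.
  have := near_infty_natSinv_lt (PosNum d0).
  move=> /filter_ex[j /= jd]; apply: le_trans (h' j I) _.
  by rewrite lerD2l ltW.
have cvA : (prod_pow mu k (A j) @[j --> \oo] --> prod_pow mu k (\bigcap_j A j))%E.
  apply: nonincreasing_cvg_mu => //.
  - by rewrite (le_lt_trans (prod_pow_le1 (mA 0%N)))// ltry.
  - exact: bigcapT_measurable.
  - move=> i j ij; apply/subsetPset => w; rewrite /A/= => /le_trans; apply.
    by rewrite lerD2l lef_pV2 ?posrE// ler_nat.
rewrite IA -sum_boxE in cvA.
have [j hj] : exists j, (prod_pow mu k (A j) < r%:E)%E.
  have : (\forall j \near \oo, prod_pow mu k (A j) < r%:E)%E.
    apply: (cvA [set y | y < r%:E]%E); apply: open_nbhs_nbhs; split.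
      exact: open_ereal_lt_ereal.
    by rewrite /= lte_fin.
  by move=> /filter_ex.
exists j.+1%:R^-1; first by rewrite invr_gt0.
move=> b hb; apply/negP; rewrite -ltNge -lte_fin sum_boxE.
apply: le_lt_trans hj; apply: le_measure; rewrite ?inE//; first exact: measurable_sum_box_set.
move=> w /= hw; rewrite /A/=.
have -> : sample_sum w - a = (sample_sum w - b) + (b - a) by rewrite addrA subrK.
by apply: le_trans (ler_normD _ _) _; apply: lerD => //; exact: ltW.
Qed.

(** Induction on [k], conditioning on the first point. For [k = 0] this is convexity of the ball;
    the step is Prekopa-Leindler for the shifted functions, as the midpoint of [a - y] and [b - z]
    is the midpoint of [a], [b] minus that of [y], [z]. *)
Lemma sum_box_mid k e a b : log_concave mu -> 0 <= e ->
  sum_box k e a * sum_box k e b <= sum_box k e (2^-1 *: (a + b)) ^+ 2.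
Proof.
move=> lc e0; elim: k a b => [|k IH] a b.
  have E v : sum_box 0 e v = (`|v| <= e)%R%:R.
    have -> : sum_box 0 e v = fine (prod_pow mu 0 (if `|v| <= e then setT else set0)).
      congr (fine (prod_pow mu 0 _)); apply/funext => w /=; apply/propext.
      by rewrite sub0r normrN; case: ifP => h; split.
    by case: ifP => _; rewrite ?prod_pow_setT ?measure0.
  rewrite !E; case: (boolP (`|a| <= e)) => ha; rewrite ?mul0r ?sqr_ge0//.
  case: (boolP (`|b| <= e)) => hb; rewrite ?mulr0 ?sqr_ge0//.
  have -> : `|2^-1 *: (a + b)| <= e.
    rewrite normrZ ger0_norm ?invr_ge0// ler_pdivrMl//.
    by apply: le_trans (ler_normD _ _) _; lra.
  by rewrite mulr1 expr1n.
pose F y := sum_box k e (a - y); pose G y := sum_box k e (b - y).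
pose H y := sum_box k e (2^-1 *: (a + b) - y).
have mF v : measurable_fun setT ((fun y => sum_box k e (v - y)) \o @vecn R n).
  apply: (mvec_rn (@measurable_sum_box k e) (X := fun y => v - vecn y)).
  by apply: mvecB; [exact: mvec_cst|exact: mvec_vecn].
have cF v r : 0 < r -> closed [set y | r <= sum_box k e (v - y)].
  move=> r0; apply/closed_rVP => y hy.
  have [d d0 hd] := (closed_rVP _).1 (@closed_sum_box k e r e0) (v - y) hy.
  exists d => // z zd; apply: hd.
  by rewrite opprB addrC addrA subrK distrC.
have := @prekopa_leindler_closed _ _ mu F G H (sum_box k.+1 e b)
  (sum_box k.+1 e (2^-1 *: (a + b))) lc (mF a) (mF b) (mF _) _ _ _ (cF a) (cF b) _ _ _.
have hF : (\int[mu]_x (F (vecn x))%:E = (sum_box k.+1 e a)%:E)%E by rewrite sum_boxS.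
rewrite hF -EFinM lee_fin; apply; rewrite ?sum_boxS//.
- by move=> x; exact: sum_box_ge0.
- by move=> x; exact: sum_box_ge0.
- by move=> x; exact: sum_box_ge0.
move=> y z; apply: le_trans (IH _ _) _; rewrite le_eqVlt; apply/orP; left; apply/eqP.
congr (sum_box k e _ ^+ 2); rewrite -scalerBr; congr (_ *: _).
by rewrite opprD addrACA.
Qed.

End sums.

(** * Convexity from closedness and midpoints *)

Section midpoint.
Context {R : realType}.

(** Bisection: for [t] in the left half take the midpoint with [x], in the right half with [y]; the
    error halves each time. *)
Lemma dyadic_segment n (C : set 'rV[R]_n) (x y : 'rV[R]_n) k t :
  (forall a b, C a -> C b -> C (2^-1 *: (a + b))) -> C x -> C y -> 0 <= t <= 1 ->
  exists2 d, `|t - d| <= 2^-1 ^+ k & C (x + d *: (y - x)).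
Proof.
move=> mid Cx Cy; elim: k t => [|k IH] t t01.
  exists 0; last by rewrite scale0r addr0.
  by rewrite subr0 expr0 ger0_norm; lra.
have [ht|ht] := leP t 2^-1.
  have [|d hd Cd] := IH (2 * t); first by lra.
  exists (2^-1 * d).
    have -> : t - 2^-1 * d = 2^-1 * (2 * t - d) by lra.
    by rewrite normrM exprS ger0_norm ?invr_ge0// ler_pM2l// invr_gt0.
  have := mid _ _ Cx Cd; congr C.
  by apply/rowP => i; rewrite !mxE; lra.
have [|d hd Cd] := IH (2 * t - 1); first by lra.
exists (2^-1 * (d + 1)).
  have -> : t - 2^-1 * (d + 1) = 2^-1 * (2 * t - 1 - d) by lra.
  by rewrite normrM exprS ger0_norm ?invr_ge0// ler_pM2l// invr_gt0.
have := mid _ _ Cy Cd; congr C.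
by apply/rowP => i; rewrite !mxE; lra.
Qed.

Lemma closed_midpoint_segment n (C : set 'rV[R]_n) (x y : 'rV[R]_n) t :
  closed C -> (forall a b, C a -> C b -> C (2^-1 *: (a + b))) ->
  C x -> C y -> 0 <= t <= 1 -> C (x + t *: (y - x)).
Proof.
move=> cC mid Cx Cy t01; have [//|nC] := pselect (C (x + t *: (y - x))).
have [e e0 he] := (closed_rVP C).1 cC _ nC.
pose M := `|y - x| + 1.
have M0 : 0 < M by rewrite ltr_wpDl.
have [k ke] : exists k, (2^-1 : R) ^+ k < e / M.
  have /cvgrPdist_lt/(_ (e / M)) : (2^-1 : R) ^+ k @[k --> \oo] --> 0.
    by apply: cvg_expr; rewrite ger0_norm ?invr_ge0// invf_lt1// ltr1n.
  rewrite divr_gt0// => /(_ isT) /filter_ex[k].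
  by rewrite sub0r normrN ger0_norm ?exprn_ge0 ?invr_ge0// => ?; exists k.
have [d hd Cd] := dyadic_segment k mid Cx Cy t01.
exfalso; apply: he Cd; rewrite opprD addrACA subrr add0r -scalerBl normrZ distrC.
apply: (@le_lt_trans _ _ (2^-1 ^+ k * M)); last by rewrite -ltr_pdivlMr.
by apply: ler_pM => //; rewrite /M lerDl.
Qed.

Lemma closed_midpoint_convex n N (C : set 'rV[R]_n) (X : 'I_N -> 'rV[R]_n) (w : 'I_N -> R) :
  closed C -> (forall a b, C a -> C b -> C (2^-1 *: (a + b))) ->
  (forall i, C (X i)) -> (forall i, 0 <= w i) -> \sum_i w i = 1 ->
  C (\sum_i w i *: X i).
Proof.
move=> cC mid; elim: N X w => [|N IH] X w CX w0 w1.
  by move: w1; rewrite big_ord0 => /esym/eqP; rewrite oner_eq0.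
rewrite big_ord_recl/=; rewrite big_ord_recl in w1.
set t := w ord0 in w1 *; set v := \sum_(i < N) w (lift ord0 i) in w1.
have v0 : 0 <= v by apply: sumr_ge0.
have t0 : 0 <= t by exact: w0.
(* If the remaining weight [v] vanishes, only the first point counts; otherwise the other weights
   are renormalised by [v]. *)
have [vE|vN] := eqVneq v 0.
  rewrite big1; last first.
    move=> i _; have : w (lift ord0 i) = 0.
      apply/eqP; rewrite eq_le w0 andbT -vE.
      by rewrite /v (bigD1 i)//= lerDl sumr_ge0.
    by move=> ->; rewrite scale0r.
  by rewrite addr0; move: w1; rewrite vE addr0 => ->; rewrite scale1r.
have vp : 0 < v by rewrite lt_def vN.
have Cz : C (\sum_(i < N) (w (lift ord0 i) / v) *: X (lift ord0 i)).
  apply: IH => //; first by move=> i; rewrite divr_ge0.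
  by rewrite -mulr_suml divff.
have := @closed_midpoint_segment n C (X ord0) _ v cC mid (CX ord0) Cz.
have v01 : 0 <= v <= 1 by lra.
move=> /(_ v01); congr C.
rewrite scalerBr scaler_sumr addrA addrAC; congr (_ + _).
  by rewrite -[X in X - _]scale1r -scalerBl; congr (_ *: _); lra.
by apply: eq_bigr => i _; rewrite scalerA mulrCA divff// mulr1.
Qed.

End midpoint.

(** * Volumes of boxes and level sets, tails of sums *)

Section volume.
Context {R : realType}.

(** The centre is indexed by [nat] so that the induction can drop a coordinate by shifting the
    index. *)
Lemma lebn_box_coord n (c e : R) (a : nat -> R) : 0 < c -> 0 <= e ->
  lebn R n [set x | forall i, (i < n)%N -> `|c * rn_coord x i - a i| <= e] = ((2 * e / c) ^+ n)%:E.
Proof.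
move=> c0 e0; elim: n a => [|n IH] a.
  rewrite expr0 (_ : [set _ | _] = setT); first exact: diracT.
  by apply/seteqP; split.
pose I1 := [set x : R | `|c * x - a 0%N| <= e].
pose B1 := [set x : Rn R n | forall i, (i < n)%N -> `|c * rn_coord x i - a i.+1| <= e].
have I1E : I1 = `[(a 0%N - e) / c, (a 0%N + e) / c]%classic.
  apply/seteqP; split => x; rewrite /I1/= in_itv/= ler_norml ler_pdivrMr// ler_pdivlMr// => ?; lra.
have mB1 : measurable B1.
  have -> : B1 = \bigcap_(i in `I_n) [set x : Rn R n | `|c * rn_coord x i - a i.+1| <= e].
    by apply/seteqP; split.
  apply: fin_bigcap_measurable => // i _.
  apply: measurable_set_le; last exact: measurable_cst.
  apply: measurableT_comp => //; apply: measurable_funB => //.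
  by apply: measurable_funM => //; exact: measurable_coord.
transitivity ((leb_sfspace R).(sf_meas) I1 * lebn R n B1)%E.
  rewrite -[RHS](product_measure1E (sf_meas (leb_sfspace R)) (lebn R n))//.
    congr (lebn R n.+1 _); apply/seteqP; split => x /=.
      by move=> h; split; [exact: (h 0%N)|move=> i lin; exact: (h i.+1)].
    by move=> [h1 h2] [|i] lin; [exact: h1|exact: (h2 i)].
  by rewrite I1E.
rewrite IH I1E /= lebesgue_measure_itv/= lte_fin ltr_pM2r ?invr_gt0//.
rewrite [in RHS]exprS [in RHS]EFinM; congr (_ * _)%E.
(* The length formula for an interval is conditional, so the degenerate case [e = 0] is separate. *)
case: ltP => h; last first.
  have -> : e = 0 by lra.
  by rewrite mulr0 mul0r.
by rewrite -EFinB; congr EFin; rewrite -mulrBl; congr (_ / _); lra.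
Qed.

Lemma lebn_box n (c e : R) (a : 'rV[R]_n) : 0 < c -> 0 <= e ->
  lebn R n [set x | `|a - c *: vecn x| <= e] = ((2 * e / c) ^+ n)%:E.
Proof.
move=> c0 e0; rewrite -(@lebn_box_coord n c e (fun i => if insub i is Some j then a 0 j else 0))//.
congr (lebn R n _); apply/seteqP; split => x /=.
  move=> /(rV_norm_le _ e0) h i lin; rewrite insubT distrC.
  by have := h (Ordinal lin); rewrite !mxE.
move=> h; apply/(rV_norm_le _ e0) => i; have := h i (ltn_ord i).
by rewrite valK distrC !mxE.
Qed.

End volume.

Section tail.
Context {R : realType} {n : nat} (mu : probability (Rn R n) R).
Local Notation leb := (lebn R n).

(** By Tonelli: for a fixed value of the sum the admissible [z] fill a box of side [2 * e / c],
    whatever that value is. *)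
Lemma integral_sum_box k (e c : R) (b : 'rV[R]_n) : 0 < c -> 0 <= e ->
  (\int[leb]_z (sum_box mu k e (b + c *: vecn z))%:E = ((2 * e / c) ^+ n)%:E)%E.
Proof.
move=> c0 e0.
have mX : mvec (fun z : Rn R n => b + c *: vecn z).
  by apply: mvecD; [exact: mvec_cst|apply: mvecZ; exact: mvec_vecn].
have := tonelli_set (prod_pow mu k) leb (@measurable_sum_box_pair _ _ mu _ _ k e _ mX).
under [X in _ = X -> _]eq_integral do rewrite /= -sum_boxE.
move=> <-.
rewrite (_ : (fun w => _) = cst ((2 * e / c) ^+ n)%:E); last first.
  apply/funext => w /=; rewrite -(lebn_box (sample_sum w - b) c0 e0).
  by congr (leb _); apply/seteqP; split => z /=; rewrite opprD addrA.
rewrite integral_cst// -[RHS]mule1; congr (_ * _)%E.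
exact: prod_pow_setT.
Qed.

Lemma measurable_sum_box_shift k e (b : 'rV[R]_n) c :
  measurable_fun setT (fun z : Rn R n => sum_box mu k e (b + c *: vecn z)).
Proof.
apply: (mvec_rn (@measurable_sum_box _ _ mu k e) (X := fun z => b + c *: vecn z)).
by apply: mvecD; [exact: mvec_cst|apply: mvecZ; exact: mvec_vecn].
Qed.

Lemma lebn_sum_box_level k (e c s : R) : 0 < c -> 0 <= e -> 0 < s ->
  (leb [set x | (s <= sum_box mu k e (c *: vecn x))%R] <= ((2 * e / c) ^+ n / s)%:E)%E.
Proof.
move=> c0 e0 s0.
have mf : measurable_fun setT (fun z : Rn R n => sum_box mu k e (c *: vecn z)).
  by have := measurable_sum_box_shift k e 0 c; congr measurable_fun; apply/funext => z; rewrite add0r.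
have mS : measurable [set x | (s <= sum_box mu k e (c *: vecn x))%R].
  by apply: measurable_set_le => //; exact: measurable_cst.
have := integral_sum_box k 0 c0 e0.
under eq_integral do rewrite add0r.
move=> E; rewrite EFinM -E muleC -[leLHS]mul1e -[1%E](_ : (s^-1 * s)%:E = 1%E); last first.
  by rewrite mulVf ?gt_eqF.
rewrite EFinM -muleA lee_pmul2l ?fin_num_fine ?lte_fin ?invr_gt0//.
rewrite -integral_cst//=.
rewrite integral_mkcond; apply: ge0_le_integral => //.
- by move=> x _; rewrite patchE; case: ifP => // _; rewrite lee_fin ltW.
- by apply/(measurable_restrictT (fun=> s%:E) mS); exact: measurable_cst.
- exact/measurable_EFinP.
- by move=> x _; rewrite patchE; case: ifPn; rewrite ?inE/= lee_fin// sum_box_ge0.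
Qed.

(* Averaging [1 = e^-n vol {z | |S - z| <= e/2}] over [S] reduces the tail to the integral of
   [sum_box mu k (e/2)] over the [z] where it is below [s]; there it is at most [sqrt s] times
   its square root, and log-concavity along [z, m] makes that square root integrable. *)
Lemma sum_box_tail k (e s : R) (m : 'rV[R]_n) : log_concave mu -> 0 < e -> 0 < s ->
  0 < sum_box mu k (e / 2) m ->
  (prod_pow mu k [set w | (sum_box mu k e (sample_sum w) < s)%R] <=
   (2 ^+ n * Num.sqrt (s / sum_box mu k (e / 2) m))%:E)%E.
Proof.
move=> lc e0 s0 m0.
set B := [set w | _].
have mB : measurable B.
  have mS := mvec_rn (@measurable_sum_box _ _ mu k e) (@mvec_sample_sum _ _ mu k).
  have -> : B = ~` [set w | s <= sum_box mu k e (sample_sum w)].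
    by apply/funext => w; apply/propext; rewrite /B/= ltNge; split => /negP.
  by apply/measurableC/measurable_set_le => //; exact: measurable_cst.
pose A := [set z : sample mu k * Rn R n | `|sample_sum z.1 - vecn z.2| <= e / 2] `&` (fst @^-1` B).
have e20 : 0 < e / 2 by rewrite divr_gt0.
have mA : measurable A.
  apply: measurableI.
    exact: (@measurable_sum_box_pair _ _ mu _ _ k (e / 2) _ (@mvec_vecn R n)).
  by rewrite -[X in measurable X]setTI; exact: (@measurable_fst _ _ (sample mu k) (Rn R n)).
have := tonelli_set (prod_pow mu k) leb mA.
have -> : (\int[prod_pow mu k]_w leb [set z | A (w, z)] = (e ^+ n)%:E * prod_pow mu k B)%E.
  rewrite -[X in prod_pow mu k X]setIT -integral_indic// -ge0_integralZl_EFin ?exprn_ge0 ?ltW//.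
    apply: eq_integral => w _; rewrite indicE.
    have [wB|wB] := boolP (w \in B).
      rewrite mule1 -[in RHS](_ : 2 * (e / 2) / 1 = e); last by lra.
      rewrite -(lebn_box (sample_sum w) ltr01 (ltW e20)); congr (leb _).
      apply/seteqP; split => z; rewrite /A/= scale1r; first by case.
      by move=> ?; split => //; move: wB; rewrite inE.
    rewrite mule0 (_ : [set z | _] = set0) ?measure0//.
    by rewrite -subset0 => z [_ /= h]; move/negP: wB; apply; rewrite inE.
  by apply/measurable_EFinP; exact: measurable_indic.
move=> E.
rewrite -(@lee_pmul2l _ (e ^+ n)%:E) ?fin_num_fine ?lte_fin ?exprn_gt0// E.
set q := sum_box mu k (e / 2) m in m0 *.
apply: (@le_trans _ _ (\int[leb]_z ((Num.sqrt (s / q)) *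
  sum_box mu k (e / 2) (2^-1 *: m + 2^-1 *: vecn z))%:E)%E).
  have ms := measurable_sum_box_shift k (e / 2) (2^-1 *: m) 2^-1.
  apply: ge0_le_integral => //.
  - exact: measurable_section2.
  - by apply/measurable_EFinP; apply: measurable_funM.
  move=> z _.
  have [h0|/set0P[w [/= w1 w2]]] := eqVneq [set w | A (w, z)] set0.
    by rewrite h0 measure0 lee_fin mulr_ge0 ?sqrtr_ge0 ?sum_box_ge0.
  set v := vecn z in w1 *.
  (* The sum is within [e / 2] of [v], so the box of radius [e / 2] at [v] lies in the box of radius
     [e] at the sum, whose mass is below [s]. *)
  have vs : sum_box mu k (e / 2) v <= s.
    apply/ltW; apply: le_lt_trans w2; rewrite -lee_fin !sum_boxE.
    apply: le_measure; rewrite ?inE; [exact: measurable_sum_box_set|exact: measurable_sum_box_set|].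
    move=> w' /= h; have -> : sample_sum w' - sample_sum w = (sample_sum w' - v) - (sample_sum w - v).
      by rewrite opprB addrA subrK.
    by apply: le_trans (ler_normB _ _) _; rewrite -/v; lra.
  apply: (@le_trans _ _ (sum_box mu k (e / 2) v)%:E).
    rewrite sum_boxE; apply: le_measure; rewrite ?inE; [exact: measurable_slice2|exact: measurable_sum_box_set|].
    by move=> w' [].
  rewrite lee_fin -scalerDr.
  have := sum_box_mid k m v lc (ltW e20); rewrite -/q.
  set t := sum_box _ _ _ (_ *: _); set u := sum_box _ _ _ v in vs * => h.
  have u0 : 0 <= u by exact: sum_box_ge0.
  have t0 : 0 <= t by exact: sum_box_ge0.
  rewrite -(@ler_pXn2r _ 2) ?nnegrE ?mulr_ge0 ?sqrtr_ge0//.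
  rewrite exprMn sqr_sqrtr; last by rewrite divr_ge0 ?ltW.
  rewrite mulrAC ler_pdivlMr//.
  (* This combines [u <= s] with [q * u <= t ^+ 2], and says that [u] is at most [sqrt (s / q)]
     times [t]. *)
  have h2 : u * (q * u) <= s * t ^+ 2 by apply: ler_pM => //; rewrite mulr_ge0// ltW.
  nra.
have ms := measurable_sum_box_shift k (e / 2) (2^-1 *: m) 2^-1.
under eq_integral do rewrite EFinM.
rewrite ge0_integralZl_EFin ?sqrtr_ge0//; last 2 first.
- by move=> z _; rewrite lee_fin sum_box_ge0.
- exact/measurable_EFinP.
(* Here [z] enters with scale [2^-1], which doubles each side; this is the origin of the factor
   [2 ^+ n]. *)
rewrite (integral_sum_box _ _ _ (ltW e20)) ?invr_gt0// -!EFinM lee_fin.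
have -> : 2 * (e / 2) / 2^-1 = e * 2 by rewrite invrK; lra.
by rewrite exprMn mulrC -mulrA.
Qed.

End tail.

(** * Comparison with a Gaussian *)

Section gauss.
Context {R : realType}.

Definition qf n (B : 'M[R]_n) (u v : 'rV[R]_n) : R := (u *m B *m v^T) 0 0.

Lemma qfE n (B : 'M[R]_n) (u v : 'rV[R]_n) :
  qf B u v = \sum_i \sum_j B i j * (u 0 i * v 0 j).
Proof.
rewrite /qf mxE; under eq_bigr do rewrite !mxE mulr_suml.
rewrite exchange_big; apply: eq_bigr => i _; apply: eq_bigr => j _.
by rewrite mulrAC mulrC mulrA.
Qed.

Lemma qfDl n (B : 'M[R]_n) u v w : qf B (u + v) w = qf B u w + qf B v w.
Proof. by rewrite /qf !mulmxDl mxE. Qed.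

Lemma qfDr n (B : 'M[R]_n) u v w : qf B w (u + v) = qf B w u + qf B w v.
Proof. by rewrite /qf linearD mulmxDr mxE. Qed.

Lemma qfNl n (B : 'M[R]_n) u v : qf B (- u) v = - qf B u v.
Proof. by rewrite /qf !mulNmx mxE. Qed.

Lemma qfNr n (B : 'M[R]_n) u v : qf B u (- v) = - qf B u v.
Proof. by rewrite /qf linearN mulmxN mxE. Qed.

Lemma qfC n (B : 'M[R]_n) u v : B^T = B -> qf B u v = qf B v u.
Proof.
move=> sB; rewrite /qf.
have -> : (u *m B *m v^T) 0 0 = (u *m B *m v^T)^T 0 0 by rewrite [RHS]mxE.
by rewrite !trmx_mul trmxK sB mulmxA.
Qed.

(** The normal density with mean [- b] and variance [1 / (2 * a)] has total mass 1. *)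
Lemma integral_gauss1 (a b : R) : 0 < a ->
  (\int[@lebesgue_measure R]_t (expR (- (a * (t + b) ^+ 2)))%:E = (Num.sqrt (pi / a))%:E)%E.
Proof.
move=> a0.
pose s : R := Num.sqrt (2 * a)^-1.
have s0 : 0 < s by rewrite sqrtr_gt0 invr_gt0 mulr_gt0.
have s2 : s ^+ 2 = (2 * a)^-1 by rewrite sqr_sqrtr// invr_ge0 mulr_ge0// ltW.
have := integral_normal_pdf (- b) s.
rewrite normal_pdfE ?gt_eqF//.
have E t : normal_peak s * normal_fun (- b) s t = (Num.sqrt (pi / a))^-1 * expR (- (a * (t + b) ^+ 2)).
  congr (_ * expR _).
    by rewrite /normal_peak s2; congr (Num.sqrt _)^-1; field; rewrite gt_eqF.
  by rewrite s2 opprK; field; rewrite gt_eqF.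
under eq_integral do rewrite E EFinM.
have mf : measurable_fun setT (fun t : R => expR (- (a * (t + b) ^+ 2))).
  do 2 apply: measurableT_comp => //.
  by apply: measurable_funM => //; apply: measurable_funX; exact: measurable_funD.
rewrite ge0_integralZl_EFin ?invr_ge0 ?sqrtr_ge0//; last first.
  exact/measurable_EFinP.
have p0 : 0 < Num.sqrt (pi / a) by rewrite sqrtr_gt0 divr_gt0// pi_gt0.
set I := (\int[_]_t _)%E => h.
have -> : (I = (Num.sqrt (pi / a))%:E * ((Num.sqrt (pi / a))^-1%:E * I))%E.
  by rewrite muleA -EFinM divff ?gt_eqF// mul1e.
by rewrite h mule1.
Qed.

Lemma vecnS n (t : R) (x : Rn R n) : vecn ((t, x) : Rn R n.+1) = row_mx (t%:M : 'rV[R]_1) (vecn x).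
Proof.
apply/rowP => i; rewrite vecnE; case: (split_ordP (i : 'I_(1 + n))) => j ->.
  by rewrite (row_mxEl (t%:M : 'rV[R]_1) (vecn x) 0 j) (ord1 j) mxE.
by rewrite (row_mxEr (t%:M : 'rV[R]_1) (vecn x) 0 j) vecnE.
Qed.

Lemma measurable_qf d (T : measurableType d) n (B : 'M[R]_n) (X Y : T -> 'rV[R]_n) :
  mvec X -> mvec Y -> measurable_fun setT (fun t => qf B (X t) (Y t)).
Proof.
move=> mX mY; under eq_fun do rewrite qfE.
apply: measurable_sum => i; apply: measurable_sum => j.
by apply: measurable_funM => //; apply: measurable_funM.
Qed.

(* Completing the square in the first variable replaces [B] by its Schur complement. *)
Lemma integral_gauss n (B : 'M[R]_n) : B^T = B -> (forall u, u != 0 -> 0 < qf B u u) ->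
  0 < \det B /\
  (\int[lebn R n]_x (expR (- qf B (vecn x) (vecn x)))%:E = (Num.sqrt (pi ^+ n / \det B))%:E)%E.
Proof.
elim: n B => [|n IH] B sB pB.
  split; first by rewrite det_mx00.
  rewrite det_mx00 expr0 divr1 sqrtr1.
  rewrite (eq_integral (cst 1%E)); last first.
    by move=> x _ /=; rewrite qfE big_ord0 oppr0 expR0.
  by rewrite integral_cst// mul1e; exact: diracT.
pose M : 'M[R]_(1 + n) := B.
pose a := ulsubmx M 0 0; pose b : 'rV[R]_n := ursubmx M; pose D := drsubmx M.
have ME : M = block_mx (a%:M) b b^T D.
  rewrite -[LHS]submxK; congr block_mx; first exact: mx11_scalar.
  by rewrite /b trmx_ursub sB.
have sD : D^T = D by rewrite /D trmx_drsub sB.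
pose d (u : 'rV[R]_n) := (u *m b^T) 0 0.
have bu u : (b *m u^T) 0 0 = d u by rewrite /d -[u *m b^T]trmxK trmx_mul trmxK [RHS]mxE.
have qE t u : qf M (row_mx (t%:M : 'rV[R]_1) u) (row_mx (t%:M : 'rV[R]_1) u) =
    a * t ^+ 2 + 2 * t * d u + qf D u u.
  have E1 : (t *: (t *: a%:M + u *m b^T) : 'M[R]_1) 0 0 = t * (t * a + d u).
    by rewrite /d !mxE eqxx mulr1n.
  have E2 : ((t *: b + u *m D) *m u^T) 0 0 = t * d u + qf D u u.
    by rewrite mulmxDl mxE -scalemxAl -bu; congr (_ + _); rewrite mxE.
  rewrite /qf ME mul_row_block tr_row_mx mul_row_col tr_scalar_mx.
  rewrite !mul_scalar_mx mul_mx_scalar mxE E1 E2 /qf expr2; ring.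
have a0 : 0 < a.
  have := pB (row_mx 1%:M 0 : 'rV[R]_(1 + n)); rewrite -/M qE /qf mul0mx mul0mx /d mul0mx !mxE.
  rewrite expr1n mulr1 mulr0 !addr0; apply; apply/eqP => /rowP /(_ (lshift n (0 : 'I_1))).
  rewrite (row_mxEl (1%:M : 'rV[R]_1) (0 : 'rV[R]_n) 0 0) !mxE eqxx => /eqP.
  by rewrite oner_eq0.
pose S := D - a^-1 *: (b^T *m b).
have qS u : qf S u u = qf D u u - a^-1 * d u ^+ 2.
  rewrite /qf /S mulmxBr mulmxBl mxE [X in _ + X]mxE; congr (_ - _).
  rewrite -scalemxAr -scalemxAl mxE; congr (_ * _).
  have -> : u *m (b^T *m b) *m u^T = (u *m b^T) *m (b *m u^T) by rewrite !mulmxA.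
  by rewrite [LHS]mxE big_ord1 bu expr2.
have sS : S^T = S by rewrite /S linearB/= linearZ/= trmx_mul trmxK sD.
have sq t u : qf M (row_mx (t%:M : 'rV[R]_1) u) (row_mx (t%:M : 'rV[R]_1) u) =
    a * (t + a^-1 * d u) ^+ 2 + qf S u u.
  by rewrite qE qS; field; rewrite gt_eqF.
(* The Schur form at [u] is the value of [M] at [(t, u)] for the [t] that annihilates the completed
   square. *)
have pS u : u != 0 -> 0 < qf S u u.
  move=> u0; have := pB (row_mx ((- (a^-1 * d u))%:M : 'rV[R]_1) u : 'rV[R]_(1 + n)).
  rewrite -/M sq addNr expr0n mulr0 add0r; apply; apply: contra u0 => /eqP/rowP h.
  apply/eqP/rowP => i; have := h (rshift 1 i).
  by rewrite (row_mxEr ((- (a^-1 * d u))%:M : 'rV[R]_1) u 0 i) !mxE.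
have [dS IS] := IH S sS pS.
(* Block elimination: [M = L *m U] with [L] unipotent and [U] carrying [a] and the Schur complement
   on its diagonal. *)
have dB : \det B = a * \det S.
  pose L := block_mx (1%:M : 'M[R]_1) 0 (a^-1 *: b^T) (1%:M : 'M[R]_n).
  pose U := block_mx (a%:M : 'M[R]_1) b 0 S.
  have dL : \det L = 1 by rewrite /L det_lblock !det1 mul1r.
  have dU : \det U = a * \det S by rewrite /U det_ublock det_scalar1.
  have MLU : M = L *m U.
    rewrite ME /L /U (mulmx_block (1%:M : 'M[R]_1)).
    rewrite !mul1mx !mul0mx !addr0 mul_mx_scalar scalerA.
    rewrite mulfV ?gt_eqF// scale1r; congr block_mx.
    by rewrite /S -scalemxAl addrC subrK.
  by rewrite -[LHS]/(\det M) MLU det_mulmx dL dU mul1r.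
split; first by rewrite dB mulr_gt0.
pose f (z : measurableTypeR R * Rn R n) :=
  (expR (- qf M (row_mx (z.1%:M : 'rV[R]_1) (vecn z.2)) (row_mx (z.1%:M : 'rV[R]_1) (vecn z.2))))%:E.
have mf : measurable_fun setT f.
  apply/measurable_EFinP; do 2 apply: measurableT_comp => //.
  have : mvec (fun z : measurableTypeR R * Rn R n => row_mx (z.1%:M : 'rV[R]_1) (vecn z.2)).
    by move=> i; have := @mvec_vecn R n.+1 i;
      congr measurable_fun; apply/funext => -[t x]; rewrite vecnS.
  by move=> mv; exact: measurable_qf.
transitivity (\int[(@lebesgue_measure R \x lebn R n)%E]_z f z)%E.
  by apply: eq_integral => -[t x] _; rewrite vecnS.
rewrite fubini_tonelli2 //; last by move=> z; rewrite lee_fin expR_ge0.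
rewrite /fubini_G.
transitivity (\int[lebn R n]_y ((Num.sqrt (pi / a))%:E * (expR (- qf S (vecn y) (vecn y)))%:E))%E.
  apply: eq_integral => y _; rewrite /f/=.
  under eq_integral do rewrite sq opprD expRD mulrC EFinM.
  rewrite ge0_integralZl_EFin ?expR_ge0//; last first.
    apply/measurable_EFinP; do 2 apply: measurableT_comp => //.
    by apply: measurable_funM => //; apply: measurable_funX; exact: measurable_funD.
  by rewrite integral_gauss1// muleC.
rewrite ge0_integralZl_EFin ?sqrtr_ge0//; last first.
  apply/measurable_EFinP; do 2 apply: measurableT_comp => //.
  by apply: measurable_qf; exact: mvec_vecn.
rewrite IS -EFinM -sqrtrM; last by rewrite divr_ge0 ?pi_ge0// ltW.
by rewrite dB exprS invfM mulrACA.

Qed.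

End gauss.

(** * Means, covariance and Jensen's inequality *)

Section has_mean.
Context {R : realType} d (T : measurableType d) (P : probability T R).

(** Bundling integrability with the value lets expectations be computed by linearity alone. *)
Definition has_mean (f : T -> R) (m : R) :=
  P.-integrable setT (fun x => (f x)%:E) /\ (\int[P]_x (f x)%:E = m%:E)%E.

Lemma has_mean_cst c : has_mean (fun=> c) c.
Proof.
split; first exact: finite_measure_integrable_cst.
by rewrite (integral_cst P measurableT c%:E) [X in (_ * X)%E](_ : _ = 1%E)
  ?mule1//; exact: probability_setT.
Qed.

Lemma has_meanD f g a b : has_mean f a -> has_mean g b -> has_mean (fun x => f x + g x) (a + b).
Proof.
move=> [fi fE] [gi gE]; split.
  by under [X in integrable _ _ X]eq_fun do rewrite EFinD; exact: integrableD.
under eq_integral do rewrite EFinD.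
by rewrite integralD// fE gE.
Qed.

Lemma has_meanZ f a c : has_mean f a -> has_mean (fun x => c * f x) (c * a).
Proof.
move=> [fi fE]; split.
  by under [X in integrable _ _ X]eq_fun do rewrite EFinM; exact: integrableZl.
under eq_integral do rewrite EFinM.
by rewrite integralZl// fE.
Qed.

Lemma has_mean_sum I (r : seq I) (f : I -> T -> R) a : (forall i, has_mean (f i) (a i)) ->
  has_mean (fun x => \sum_(i <- r) f i x) (\sum_(i <- r) a i).
Proof.
move=> h; elim: r => [|i r IH].
  by under eq_fun do rewrite big_nil; rewrite big_nil; exact: has_mean_cst.
by under eq_fun do rewrite big_cons; rewrite big_cons; exact: has_meanD.
Qed.

Lemma has_mean_le f g a b : has_mean f a -> has_mean g b -> (forall x, f x <= g x) -> a <= b.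
Proof.
move=> [fi fE] [gi gE] fg; rewrite -lee_fin -fE -gE; apply: le_integral => //.
by move=> x _; rewrite lee_fin.
Qed.

(** Jensen's inequality, by integrating the tangent line of [expR (- t)] at [t = m]. *)
Lemma expRN_mean_le (f : T -> R) m : measurable_fun setT f -> (forall x, 0 <= f x) -> has_mean f m ->
  ((expR (- m))%:E <= \int[P]_x (expR (- f x))%:E)%E.
Proof.
move=> mf f0 fm.
have me : measurable_fun setT (fun x => expR (- f x)) by do 2 apply: measurableT_comp => //.
have [I hI] : exists I, has_mean (fun x => expR (- f x)) I.
  have ie : P.-integrable setT (fun x => (expR (- f x))%:E).
    apply: (@le_integrable _ _ _ _ _ measurableT _ (fun=> 1%E)) => //.
    - exact/measurable_EFinP.
    - move=> x _; rewrite !gee0_abs ?lee_fin ?expR_ge0//.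
      by rewrite -expR0 ler_expR oppr_le0.
    - exact: finite_measure_integrable_cst.
  exists (fine (\int[P]_x (expR (- f x))%:E)%E); split => //.
  by rewrite fineK//; exact: integrable_fin_num.
have ht : has_mean (fun x => expR (- m) + (expR (- m) * m + (- expR (- m)) * f x))
    (expR (- m) + (expR (- m) * m + (- expR (- m)) * m)).
  by apply: has_meanD; [|apply: has_meanD; [|exact: has_meanZ]]; exact: has_mean_cst.
rewrite hI.2 lee_fin; have := has_mean_le ht hI; rewrite mulNr subrr addr0; apply => x.
have -> : - f x = - m + (m - f x) by lra.
rewrite expRD; have := expR_ge1Dx (m - f x); have := expR_gt0 (- m); nra.
Qed.

End has_mean.

Section moments2.
Context {R : realType} {n : nat} (mu : probability (Rn R n) R).
Hypotheses (lc : log_concave mu) (cen : centered mu).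

Lemma barycenter0 i : barycenter mu 0 i = 0.
Proof. by rewrite mxE (cen i).2. Qed.

Lemma mean_coord i : has_mean mu (fun x => vecn x 0 i) 0.
Proof. exact: cen. Qed.

Lemma mean_coord2 i j : has_mean mu (fun x => vecn x 0 i * vecn x 0 j) (Cov mu i j).
Proof.
have int2 := log_concave_integrable2 i j lc cen.
split => //; rewrite mxE.
under [in RHS]eq_integral do rewrite !barycenter0 !subr0.
by rewrite fineK//; exact: integrable_fin_num.
Qed.

Lemma Cov_tr : (Cov mu)^T = Cov mu.
Proof.
apply/matrixP => i j; rewrite !mxE; congr fine; apply: eq_integral => x _.
by rewrite mulrC.
Qed.

Lemma mean_qf (B : 'M[R]_n) :
  has_mean mu (fun x => qf B (vecn x) (vecn x)) (\tr (B *m Cov mu)).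
Proof.
under eq_fun do rewrite qfE.
rewrite /mxtrace; under eq_bigr do rewrite mxE.
apply: has_mean_sum => i; apply: has_mean_sum => j.
by rewrite -Cov_tr mxE; apply: has_meanZ; exact: mean_coord2.
Qed.

Lemma mean_qf1 (B : 'M[R]_n) a : has_mean mu (fun x => qf B a (vecn x)) 0.
Proof.
under eq_fun do rewrite qfE.
have z : \sum_i \sum_j B i j * (a 0 i * 0) = 0 :> R.
  by rewrite big1// => i _; rewrite big1// => j _; rewrite !mulr0.
suff : has_mean mu (fun x => \sum_i \sum_j B i j * (a 0 i * vecn x 0 j))
  (\sum_i \sum_j B i j * (a 0 i * 0)) by rewrite z.
apply: has_mean_sum => i; apply: has_mean_sum => j.
by apply: has_meanZ; apply: has_meanZ; exact: mean_coord.
Qed.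

Lemma mean_qf_shift (B : 'M[R]_n) a : B^T = B ->
  has_mean mu (fun x => qf B (a + vecn x) (a + vecn x)) (qf B a a + \tr (B *m Cov mu)).
Proof.
move=> sB.
have -> : (fun x => qf B (a + vecn x) (a + vecn x)) =
    (fun x => (qf B a a + 2 * qf B a (vecn x)) + qf B (vecn x) (vecn x)).
  by apply/funext => x; rewrite qfDl !qfDr (qfC (vecn x) a sB); lra.
apply: has_meanD; last exact: mean_qf.
rewrite -[X in has_mean _ _ X]addr0 -[X in _ + X](mulr0 2).
by apply: has_meanD; [exact: has_mean_cst|apply: has_meanZ; exact: mean_qf1].
Qed.

(** The form is the second moment of the functional given by [u]. Were it zero, [mu] would be
    carried by [hyperplane u 0], contrary to the second clause of [log_concave]. *)
Lemma Cov_pos u : u != 0 -> 0 < qf (Cov mu) u u.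
Proof.
move=> u0.
pose B := u^T *m u.
have BE v : qf B v v = (\sum_i u 0 i * v 0 i) ^+ 2.
  rewrite qfE expr2 mulr_suml; apply: eq_bigr => i _; rewrite mulr_sumr.
  by apply: eq_bigr => j _; rewrite !mxE big_ord1 !mxE; ring.
have E : \tr (B *m Cov mu) = qf (Cov mu) u u.
  by rewrite /B -mulmxA mxtrace_mulC /qf /mxtrace big_ord1.
have [iq hq] := mean_qf B.
have q0 x : 0 <= qf B (vecn x) (vecn x) by rewrite BE sqr_ge0.
rewrite -E lt_neqAle; apply/andP; split; last first.
  by rewrite -lee_fin -hq; apply: integral_ge0 => x _; rewrite lee_fin.
apply/eqP => t0; rewrite -t0 in hq.
have mq : measurable_fun setT (fun x : Rn R n => (qf B (vecn x) (vecn x))%:E).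
  by apply/measurable_EFinP; apply: measurable_qf; exact: mvec_vecn.
have : (\int[mu]_x `|(qf B (vecn x) (vecn x))%:E| = 0)%E.
  by apply: (etrans _ hq); apply: eq_integral => x _; rewrite gee0_abs// lee_fin q0.
move=> /(ae_eq_integral_abs mu measurableT mq) [N [mN N0 sN]].
have mH : measurable (hyperplane u 0).
  have mf : measurable_fun setT (fun x : Rn R n => \sum_i u 0 i * vecn x 0 i).
    by apply: measurable_sum => i; apply: measurable_funM => //; exact: mvec_vecn.
  have -> : hyperplane u 0 = (fun x : Rn R n => \sum_i u 0 i * vecn x 0 i) @^-1` [set 0] by [].
  by rewrite -[X in measurable X]setTI; apply: mf.
have := lc.2 u 0 u0; rewrite ltNge => /negP; apply.
have -> : 1%E = mu (~` N).
  by rewrite probability_setC// N0 sube0.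
apply: le_measure; rewrite ?inE//; first exact: measurableC.
move=> x Nx; apply/eqP; rewrite -sqrf_eq0 -BE; apply/eqP.
have [//|h] := pselect (qf B (vecn x) (vecn x) = 0).
by exfalso; apply: Nx; apply: sN => /= /(_ I) [].
Qed.

(** Jensen is applied one point at a time: since [mu] is centered, each point adds exactly
    [\tr (B *m Cov mu)] to the mean of the form at the shifted point. *)
Lemma sample_sum_expR_qf (B : 'M[R]_n) c k a : B^T = B -> (forall u, 0 <= qf B u u) -> 0 <= c ->
  ((expR (- (c * (qf B a a + k%:R * \tr (B *m Cov mu)))))%:E <=
   \int[prod_pow mu k]_w (expR (- (c * qf B (a + sample_sum w) (a + sample_sum w))))%:E)%E.
Proof.
move=> sB pB c0; set v := \tr _.
have v0 : 0 <= v.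
  have [_ h] := mean_qf B; rewrite -lee_fin -h.
  by apply: integral_ge0 => x _; rewrite lee_fin.
elim: k a => [|k IH] a.
  rewrite mul0r addr0 (eq_integral (cst (expR (- (c * qf B a a)))%:E)); last first.
    by move=> w _ /=; rewrite addr0.
  by rewrite integral_cst// [X in (_ * X)%E]prod_pow_setT mule1.
have mv k' b : mvec (fun w : sample mu k' => b + sample_sum w).
  by apply: mvecD; [exact: mvec_cst|exact: mvec_sample_sum].
have mG k' b : measurable_fun setT (fun w : sample mu k' =>
    (expR (- (c * qf B (b + sample_sum w) (b + sample_sum w))))%:E).
  apply/measurable_EFinP; do 2 apply: measurableT_comp => //.
  by apply: measurable_funM => //; apply: measurable_qf.
rewrite (integral_prod_powS (mG k.+1 a)); last by move=> w; rewrite lee_fin expR_ge0.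
pose f (y : Rn R n) := c * (qf B (a + vecn y) (a + vecn y) + k%:R * v).
have mf : measurable_fun setT f.
  apply: measurable_funM => //; apply: measurable_funD => //.
  by apply: measurable_qf; apply: mvecD; (exact: mvec_cst || exact: mvec_vecn).
have f0 y : 0 <= f y by rewrite mulr_ge0// addr_ge0// mulr_ge0.
have hf : has_mean mu f (c * (qf B a a + k.+1%:R * v)).
  have -> : qf B a a + k.+1%:R * v = (qf B a a + v) + k%:R * v.
    by rewrite -addn1 natrD; lra.
  apply: has_meanZ; apply: has_meanD; last exact: has_mean_cst.
  exact: mean_qf_shift.
apply: le_trans (expRN_mean_le mf f0 hf) _.
apply: ge0_le_integral => //.
- by apply/measurable_EFinP; do 2 apply: measurableT_comp => //.
- exact: (measurable_fun_fubini_tonelli_F (m2 := prod_pow mu k) _ (mG k.+1 a)).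
move=> y _; apply: le_trans (IH (a + vecn y)) _.
rewrite le_eqVlt; apply/orP; left; apply/eqP; apply: eq_integral => w _ /=.
by rewrite !addrA.
Qed.

End moments2.

Section concentration.
Context {R : realType} {n : nat} (mu : probability (Rn R n) R).
Hypotheses (lc : log_concave mu) (cen : centered mu).

Lemma qf_norm_le (B : 'M[R]_n) u : qf B u u <= `|u| ^+ 2 * \sum_i \sum_j `|B i j|.
Proof.
rewrite qfE mulr_sumr; apply: ler_sum => i _; rewrite mulr_sumr; apply: ler_sum => j _.
apply: le_trans (ler_norm _) _; rewrite mulrC !normrM expr2.
by apply: ler_wpM2r => //; apply: ler_pM => //; exact: rV_coord_le.
Qed.

Lemma Cov_det_gt0 : 0 < \det (Cov mu).
Proof. by have [] := integral_gauss (Cov_tr mu) (@Cov_pos _ _ _ lc cen). Qed.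

(* The Gaussian with inverse covariance [Q] compares the Jensen lower bound
   [E exp(-q(S)/2k) >= exp(-n/2)] with the mass of [S] on small boxes. *)
Lemma sum_box_max k : (0 < n)%N -> (0 < k)%N ->
  exists2 e : R, 0 < e & exists m,
    expR (- (2 * n%:R)) * e ^+ n / Num.sqrt ((4 * k%:R * pi) ^+ n * \det (Cov mu))
      <= sum_box mu k (e / 2) m.
Proof.
move=> n0 k0; have dK := Cov_det_gt0; set K := Cov mu in dK *.
have k0' : 0 < k%:R :> R by rewrite ltr0n.
have uK : K \in unitmx by rewrite unitmxE unitfE gt_eqF.
pose Q := invmx K.
have sQ : Q^T = Q by rewrite /Q trmx_inv Cov_tr.
have QE u : qf Q u u = qf K (u *m Q) (u *m Q).
  by rewrite /qf trmx_mul sQ -!mulmxA (mulmxA K) mulmxV// mul1mx.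
have pQ u : u != 0 -> 0 < qf Q u u.
  move=> u0; rewrite QE; apply: Cov_pos => //; apply: contra u0 => /eqP uQ.
  by rewrite -[u]mulmx1 -(mulVmx uK) mulmxA uQ mul0mx.
have pQ0 u : 0 <= qf Q u u.
  by have [->|/pQ/ltW//] := eqVneq u 0; rewrite /qf !mul0mx mxE.
(* With this rate the mean exponent is [c * k * \tr (Q *m K) = n / 2]. *)
pose c : R := (2 * k%:R)^-1.
have c0 : 0 < c by rewrite invr_gt0 mulr_gt0.
have c1 : c <= 1 by rewrite invf_le1 ?mulr_gt0// -natrM ler1n muln_gt0 k0.
pose T := \sum_i \sum_j `|Q i j|.
have T0 : 0 <= T by apply: sumr_ge0 => i _; apply: sumr_ge0.
(* [T] bounds the form [Q] on the unit cube, so [Q] is at most 1 on vectors of norm at most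
   [e / 2]. *)
pose e := (1 + T)^-1.
have T1 : 0 < 1 + T by rewrite ltr_pwDl.
have e0 : 0 < e by rewrite invr_gt0.
have e20 : 0 < e / 2 by rewrite divr_gt0.
have eT : e * (1 + T) = 1 by rewrite mulVf// gt_eqF.
have e1 : e <= 1 by rewrite invf_le1// lerDl.
pose Z := Num.sqrt ((4 * k%:R * pi) ^+ n * \det K).
have Z0 : 0 < Z by rewrite sqrtr_gt0 mulr_gt0// exprn_gt0// !mulr_gt0// pi_gt0.
(* The rate is [c / 2] because moving the form from the sum to a nearby [z] costs a factor 2; the
   determinant of [c / 2 *: Q] produces [4 * k * pi] and [\det K]. *)
have gZ : (\int[lebn R n]_z (expR (- (c / 2 * qf Q (vecn z) (vecn z))))%:E = Z%:E)%E.
  have qZ u : qf ((c / 2) *: Q) u u = c / 2 * qf Q u u.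
    by rewrite /qf -scalemxAr -scalemxAl mxE.
  have pB u : u != 0 -> 0 < qf ((c / 2) *: Q) u u.
    by move=> /pQ h; rewrite qZ mulr_gt0// divr_gt0.
  have sB : ((c / 2) *: Q)^T = (c / 2) *: Q by rewrite linearZ/= sQ.
  have [_] := integral_gauss sB pB.
  under eq_integral do rewrite qZ.
  move=> ->; congr EFin; rewrite /Z detZ det_inv; congr Num.sqrt.
  rewrite invfM invrK mulrA -exprVn -exprMn; congr (_ ^+ _ * _).
  by rewrite /c; field; rewrite gt_eqF.
exists e => //; apply: contrapT => /forallNP hm.
pose M0 := expR (- (2 * n%:R)) * e ^+ n / Z.
have M00 : 0 <= M0 by rewrite divr_ge0 ?ltW// mulr_gt0 ?expR_gt0// exprn_gt0.
have {}hm m : sum_box mu k (e / 2) m <= M0.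
  by apply/ltW; rewrite ltNge; apply/negP; exact: hm.
pose A := [set z : sample mu k * Rn R n | `|sample_sum z.1 - vecn z.2| <= e / 2].
have mA : measurable A := @measurable_sum_box_pair _ _ mu _ _ k (e / 2) _ (@mvec_vecn R n).
pose g (w : sample mu k) := expR (- (c * qf Q (sample_sum w) (sample_sum w))).
have mg : measurable_fun setT g.
  do 2 apply: measurableT_comp => //; apply: measurable_funM => //.
  by apply: measurable_qf; exact: mvec_sample_sum.
have g0 w : 0 <= g w by exact: expR_ge0.
pose f (z : sample mu k * Rn R n) := (g z.1 * \1_A z)%:E.
have mf : measurable_fun setT f.
  apply/measurable_EFinP; apply: measurable_funM; first exact: (measurableT_comp mg).
  exact: measurable_indic.
have f0 z : (0 <= f z)%E by rewrite lee_fin mulr_ge0.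
have tf := fubini_tonelli (m1 := prod_pow mu k) (m2 := lebn R n) f mf f0.
have lower : ((e ^+ n * expR (- (n%:R / 2)))%:E <=
    \int[prod_pow mu k]_w \int[lebn R n]_z f (w, z))%E.
  have -> : (\int[prod_pow mu k]_w \int[lebn R n]_z f (w, z) =
      (e ^+ n)%:E * \int[prod_pow mu k]_w (g w)%:E)%E.
    rewrite -ge0_integralZl_EFin ?exprn_ge0 ?(ltW e0)//; last exact/measurable_EFinP.
    apply: eq_integral => w _; rewrite /f/=.
    under eq_integral do rewrite EFinM.
    rewrite ge0_integralZl_EFin//; last first.
      apply/measurable_EFinP.
      exact: (measurable_fun_pair2 (f := \1_A : _ -> R) w (measurable_indic mA)).
    rewrite muleC; congr (_ * _)%E.
    have mAw : measurable [set z | A (w, z)] by exact: measurable_slice1.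
    transitivity (\int[lebn R n]_z (\1_[set z | A (w, z)] z)%:E)%E.
      by apply: eq_integral => z _; rewrite !indicE !mem_setE.
    rewrite integral_indic// setIT -[in RHS](_ : 2 * (e / 2) / 1 = e); last by lra.
    rewrite -(lebn_box (sample_sum w) ltr01 (ltW e20)); congr (lebn R n _).
    by apply/seteqP; split => z; rewrite /A/= scale1r.
    by move=> w _; rewrite lee_fin g0.
  rewrite EFinM lee_pmul2l ?fin_num_fine ?lte_fin ?exprn_gt0//.
  have := sample_sum_expR_qf lc cen k 0 sQ pQ0 (ltW c0).
  rewrite -/K mulVmx// mxtrace1.
  have -> : c * (qf Q 0 0 + k%:R * n%:R) = n%:R / 2.
    by rewrite /qf !mul0mx mxE add0r /c; field; rewrite gt_eqF.
  move=> h; apply: le_trans h _; rewrite le_eqVlt; apply/orP; left; apply/eqP.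
  by apply: eq_integral => w _; rewrite add0r.
have upper : (\int[lebn R n]_z \int[prod_pow mu k]_w f (w, z) <=
    (expR n%:R * M0 * Z)%:E)%E.
  have mb : measurable_fun setT (fun z : Rn R n => expR (- (c / 2 * qf Q (vecn z) (vecn z)))).
    do 2 apply: measurableT_comp => //; apply: measurable_funM => //.
    by apply: measurable_qf; exact: mvec_vecn.
  have hEM : 0 <= expR n%:R * M0 by rewrite mulr_ge0 ?expR_ge0.
  rewrite EFinM -gZ -ge0_integralZl_EFin//; last first.
    exact/measurable_EFinP.
  apply: ge0_le_integral => //.
  - by move=> z _; apply: integral_ge0.
  - exact: (measurable_fun_fubini_tonelli_G (m1 := prod_pow mu k) f mf f0).
  - by apply/measurable_EFinP; exact: measurable_funM.
  move=> z _.
  set E := expR (- _).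
  have E0 : 0 <= E by exact: expR_ge0.
  apply: (@le_trans _ _ (\int[prod_pow mu k]_w ((expR n%:R * E)%:E * (\1_[set w | A (w, z)] w)%:E))%E).
    have mAz : measurable [set w | A (w, z)] by exact: measurable_slice2.
    apply: ge0_le_integral => //.
    - exact: (measurable_fun_pair1 z mf).
    - by apply/measurable_EFinP; apply: measurable_funM => //; exact: measurable_indic.
    move=> w _; rewrite /f -EFinM lee_fin !indicE.
    have -> : (w \in [set w | A (w, z)]) = ((w, z) \in A) by apply/idP/idP; rewrite !inE.
    have [/set_mem h|_] := boolP ((w, z) \in A); rewrite ?mulr1 ?mulr0//.
    rewrite /A/= in h.
    rewrite /g /E -expRD ler_expR.
    set y := sample_sum w in h *; set v := vecn z in h *.
    have hd : qf Q (y - v) (y - v) <= 1.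
      apply: le_trans (qf_norm_le _ _) _; rewrite -/T.
      have := normr_ge0 (y - v); nra.
    (* Nonnegativity at [2y - v] together with [hd] gives [q(v) <= 2 q(y) + 2]; the additive term
       contributes at most [c <= 1 <= n] to the exponent. *)
    have hs := pQ0 (y + y - v).
    move: hd hs; rewrite !(qfDl, qfDr, qfNl, qfNr) (qfC v y sQ) => hd hs.
    have hn : 1 <= n%:R :> R by rewrite ler1n.
    have h2 : qf Q v v <= 2 * qf Q y y + 2 by lra.
    have h3 : c * qf Q v v <= c * (2 * qf Q y y + 2) by rewrite ler_wpM2l// ltW.
    lra.
  have hE : 0 <= expR n%:R * E by rewrite mulr_ge0 ?expR_ge0.
  rewrite ge0_integralZl_EFin//; last first.
    by apply/measurable_EFinP; apply: measurable_indic; exact: measurable_slice2.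
  rewrite integral_indic//; last exact: measurable_slice2.
  rewrite setIT.
  rewrite [X in (_ * X <= _)%E](_ : _ = (sum_box mu k (e / 2) (vecn z))%:E); last by rewrite sum_boxE.
  rewrite -EFinM lee_fin.
  rewrite [leRHS]mulrAC; exact: ler_wpM2l.
(* If every box mass were at most [M0], cancelling [e ^+ n] would leave
   [expR (- n / 2) <= expR (- n)]. *)
have := le_trans lower (le_trans _ upper); rewrite tf => /(_ (lexx _)).
rewrite lee_fin /M0 -!mulrA mulVf ?gt_eqF// mulr1 mulrA -expRD mulrC.
rewrite ler_pM2r ?exprn_gt0// ler_expR.
have : 0 < n%:R :> R by rewrite ltr0n.
lra.
Qed.

End concentration.

(** * Concentration of sums on a convex set *)

Section concentration_set.
Context {R : realType}.

(** The product of [4 * expR 4] from the level [tau], of 2 from the side [2 * e] of a box, and of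
    [expR 2] and [sqrt (4 * pi)] from the lower bound for the largest box mass. *)
Definition vol_const : R := 8 * expR 6 * Num.sqrt (4 * pi).

Lemma vol_const_gt0 : 0 < vol_const.
Proof. by rewrite !mulr_gt0// ?expR_gt0// sqrtr_gt0 mulr_gt0// pi_gt0. Qed.

Lemma sqrtrX (x : R) k : 0 <= x -> Num.sqrt (x ^+ k) = Num.sqrt x ^+ k.
Proof.
move=> x0; elim: k => [|k IH]; first by rewrite !expr0 sqrtr1.
by rewrite !exprS sqrtrM// IH.
Qed.

Lemma concentration_set n (mu : probability (Rn R n) R) k :
  log_concave mu -> centered mu -> (0 < n)%N -> (0 < k)%N ->
  exists C : set 'rV[R]_n,
    [/\ closed C, forall a b, C a -> C b -> C (2^-1 *: (a + b)),
       (prod_pow mu k [set w | ~ C (sample_sum w)] <= (expR (- (2 * n%:R)))%:E)%E &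
       (lebn R n [set x | C (k%:R *: vecn x)] <=
          ((vol_const / Num.sqrt k%:R) ^+ n * Num.sqrt (\det (Cov mu)))%:E)%E].
Proof.
move=> lc cen n0 k0.
have [e e0 [m hm]] := sum_box_max lc cen n0 k0.
have dK := Cov_det_gt0 lc cen; set D := \det (Cov mu) in hm dK *.
have k0' : 0 < k%:R :> R by rewrite ltr0n.
set q := sum_box mu k (e / 2) m in hm.
pose Z := Num.sqrt ((4 * k%:R * pi) ^+ n * D).
have Z0 : 0 < Z by rewrite sqrtr_gt0 mulr_gt0// exprn_gt0// !mulr_gt0// pi_gt0.
have q0 : 0 < q.
  apply: lt_le_trans hm; rewrite divr_gt0// mulr_gt0 ?expR_gt0//.
  exact: exprn_gt0.
(* Chosen so that [2 * sqrt tau = expR (- 2)], which makes the tail bound exactly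
   [expR (- (2 * n))]. *)
pose tau : R := expR (- 4) / 4.
have tau0 : 0 < tau by rewrite divr_gt0// expR_gt0.
pose s := tau ^+ n * q.
have s0 : 0 < s by rewrite mulr_gt0// exprn_gt0.
have e0' := ltW e0.
exists [set b | s <= sum_box mu k e b]; split.
- exact: closed_sum_box.
- move=> a b /= ha hb.
  rewrite -(@ler_pXn2r _ 2) ?nnegrE ?sum_box_ge0 ?(ltW s0)//.
  apply: le_trans (sum_box_mid k a b lc e0').
  by rewrite expr2; apply: ler_pM => //; exact: ltW.
- have -> : [set w | ~ (s <= sum_box mu k e (@sample_sum _ _ mu k w))%R] =
            [set w | (sum_box mu k e (sample_sum w) < s)%R].
    by apply/funext => w; apply/propext; rewrite /= ltNge; split => /negP.
  apply: le_trans (sum_box_tail lc e0 s0 q0) _; rewrite -/q lee_fin.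
  rewrite /s mulfK ?gt_eqF// (sqrtrX _ (ltW tau0)) -exprMn.
  have -> : 2 * Num.sqrt tau = expR (- 2).
    rewrite -[2 in LHS](ger0_norm (ltW (@ltr0n R 2))) -sqrtr_sqr -sqrtrM ?sqr_ge0//.
    rewrite -[RHS](ger0_norm (expR_ge0 _)) -sqrtr_sqr; congr Num.sqrt.
    rewrite /tau -expRM_natl -[2%:R * _]/(2 * - 2); have -> : 2 * - 2 = - 4 :> R by lra.
    by field.
  have -> : expR (- 2) ^+ n = expR (- (2 * n%:R)) :> R by rewrite -expRM_natl; congr expR; lra.
  exact: lexx.
- apply: le_trans (lebn_sum_box_level mu k k0' e0' s0) _.
  rewrite lee_fin ler_pdivrMr//.
  (* After inserting the lower bound for [q], [e ^+ n] cancels, and [k] from the dilation against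
     [sqrt k] from [Z] leaves [1 / sqrt k] per dimension. *)
  apply: (@le_trans _ _ ((vol_const / Num.sqrt k%:R) ^+ n * Num.sqrt D *
     (tau ^+ n * (expR (- (2 * n%:R)) * e ^+ n / Z)))); last first.
    rewrite ler_wpM2l// ?mulr_ge0 ?sqrtr_ge0// ?exprn_ge0 ?divr_ge0 ?sqrtr_ge0 ?(ltW vol_const_gt0)//.
    by rewrite ler_wpM2l// exprn_ge0// ltW.
  have sk0 : 0 < Num.sqrt (k%:R : R) by rewrite sqrtr_gt0.
  have sk2 : Num.sqrt (k%:R : R) ^+ 2 = k%:R by rewrite sqr_sqrtr// ltW.
  have sD0 : 0 < Num.sqrt D by rewrite sqrtr_gt0.
  have p0 : 0 < Num.sqrt (4 * pi : R) by rewrite sqrtr_gt0 mulr_gt0// pi_gt0.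
  have ZE : Z = (Num.sqrt (4 * pi) * Num.sqrt k%:R) ^+ n * Num.sqrt D.
    have h4 : 0 <= 4 * pi :> R by rewrite mulr_ge0// pi_ge0.
    rewrite /Z sqrtrM; last by rewrite exprn_ge0// !mulr_ge0// pi_ge0.
    congr (_ * _); rewrite sqrtrX; last by rewrite !mulr_ge0// pi_ge0.
    by congr (_ ^+ _); rewrite mulrAC sqrtrM.
  have -> : expR (- (2 * n%:R)) = expR (- 2) ^+ n :> R.
    by rewrite -expRM_natl; congr expR; lra.
  rewrite ZE invfM.
  have -> : (vol_const / Num.sqrt k%:R) ^+ n * Num.sqrt D *
      (tau ^+ n * (expR (- 2) ^+ n * e ^+ n *
         (((Num.sqrt (4 * pi) * Num.sqrt k%:R) ^+ n)^-1 * (Num.sqrt D)^-1))) =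
      ((vol_const / Num.sqrt k%:R) * tau * expR (- 2) * e / (Num.sqrt (4 * pi) * Num.sqrt k%:R)) ^+ n.
    have : Num.sqrt (4 * pi) * Num.sqrt k%:R != 0 :> R by rewrite gt_eqF// mulr_gt0.
    move: (_ * Num.sqrt k%:R) (vol_const / _) => P V P0.
    rewrite expr_div_n !exprMn !exprVn.
    have := expf_neq0 n P0; have : Num.sqrt D != 0 by rewrite gt_eqF.
    move: (V ^+ n) (_ / 4 ^+ n) (_ ^+ n) (e ^+ n) (P ^+ n) (Num.sqrt D) => x1 x2 x3 x4 x5 x6 *.
    by field; apply/andP.
  rewrite le_eqVlt; apply/orP; left; apply/eqP; congr (_ ^+ _).
  rewrite /vol_const /tau -[X in _ / X = _]sk2.
  have -> : expR 6 = (expR (- 4) * expR (- 2))^-1 :> R.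
    by rewrite -expRD -expRN; congr expR; lra.
  have := expR_gt0 (- 4 : R); have := expR_gt0 (- 2 : R); move: sk0 p0.
  move: (expR (- 4 : R)) (expR (- 2 : R)) (Num.sqrt (k%:R : R)) (Num.sqrt (4 * pi : R)) => x1 x2 x3 x4 *.
  by field; rewrite !gt_eqF.
Qed.

End concentration_set.

(** * Random polytopes *)

Section hull.
Context {R : realType}.

Lemma lipschitz_rV_continuous N (f : 'rV[R]_N -> R) L :
  (forall u v, `|f u - f v| <= L * `|u - v|) -> continuous f.
Proof.
move=> fL u; apply: (@cvgrPdist_lt R R _ (nbhs u) _ f (f u)).2 => e e0.
pose M := Num.max L 0 + 1.
have M0 : 0 < M by rewrite ltr_wpDl// le_max lexx orbT.
apply/nbhs_ballP; exists (e / M); first by rewrite /= divr_gt0.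
move=> v; rewrite -ball_normE /ball_/= ltr_pdivlMr// => h.
apply: le_lt_trans (fL u v) _; apply: le_lt_trans h; rewrite mulrC ler_wpM2l//.
by rewrite /M; apply: (@le_trans _ _ (Num.max L 0)); [rewrite le_max lexx|rewrite lerDl].
Qed.

(** For nonnegative [l] this vanishes exactly when [l] exhibits [y] as a convex combination of the
    [X i]. *)
Definition hull_defect n N (X : 'I_N -> 'rV[R]_n) (y : 'rV[R]_n) (l : 'rV[R]_N) : R :=
  `|\sum_i l 0 i - 1| + `|y - \sum_i l 0 i *: X i|.

Lemma hull_defect_lipschitz n N (X : 'I_N -> 'rV[R]_n) y u v :
  `|hull_defect X y u - hull_defect X y v| <= (\sum_i (1 + `|X i|)) * `|u - v|.
Proof.
rewrite /hull_defect opprD addrACA; apply: le_trans (ler_normD _ _) _.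
rewrite big_split/= mulrDl; apply: lerD.
  apply: le_trans (ler_dist_dist _ _) _.
  rewrite opprB addrA subrK -sumrB mulr_suml; apply: le_trans (ler_norm_sum _ _ _) _.
  by apply: ler_sum => i _; rewrite mul1r; have := rV_coord_le (u - v) i; rewrite !mxE.
apply: le_trans (ler_dist_dist _ _) _.
rewrite opprB addrC addrA subrK -sumrB mulr_suml distrC.
apply: le_trans (ler_norm_sum _ _ _) _; apply: ler_sum => i _.
rewrite -scalerBl normrZ mulrC ler_wpM2l//.
by have := rV_coord_le (v - u) i; rewrite !mxE.
Qed.

(** Rational weights turn membership in the hull into countably many conditions, which makes it
    measurable. True weights are approximated from above, hence stay nonnegative; conversely,
    compactness of the cube [[0, 2]^N] makes the infimum 0 of the defect attained. *)
Lemma conv_hullP n N (X : 'I_N -> 'rV[R]_n) (y : 'rV[R]_n) :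
  conv_hull X y <-> forall m : nat, exists2 l : 'rV[rat]_N,
    (forall i, 0 <= (ratr (l 0 i) : R) <= 2) & hull_defect X y (map_mx ratr l) <= m.+1%:R^-1.
Proof.
split.
  move=> [w [w0 [w1 wy]]] m.
  have w1' i : w i <= 1 by rewrite -w1 (bigD1 i)//= lerDl sumr_ge0.
  pose L := \sum_i (1 + `|X i|).
  have L0 : 0 <= L by apply: sumr_ge0 => i _; rewrite addr_ge0.
  have m0 : 0 < m.+1%:R^-1 :> R by rewrite invr_gt0.
  (* [L] is the Lipschitz constant of the defect, so an error [d] costs at most [1/(m+1)]; [d <= 1]
     keeps the weights below 2. *)
  pose d := m.+1%:R^-1 / (1 + L) : R.
  have d0 : 0 < d by rewrite divr_gt0// ltr_pwDl.
  have d1 : d <= 1.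
    rewrite ler_pdivrMr ?ltr_pwDl// mul1r (@le_trans _ _ 1)//; last by rewrite lerDl.
    by rewrite invf_le1// ler1n.
  have hq i : exists q : rat, w i < ratr q < w i + d.
    by have /rat_in_itvoo[q] : w i < w i + d; [rewrite ltrDl|rewrite in_itv; exists q].
  pose l := \row_i projT1 (cid (hq i)).
  have lE i : w i < ratr (l 0 i) < w i + d by rewrite mxE; case: (cid (hq i)).
  exists l.
    move=> i; have /andP[h1 h2] := lE i; have := w0 i; have := w1' i; move: d1; lra.
  have wd : hull_defect X y (\row_i w i) = 0.
    rewrite /hull_defect wy; under eq_bigr do rewrite mxE.
    rewrite w1 subrr normr0 add0r; apply/eqP; rewrite normr_eq0 subr_eq0; apply/eqP.
    by apply: eq_bigr => i _; rewrite mxE.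
  apply: le_trans (ler_norm _) _.
  rewrite -[X in `|X|]subr0 -wd; apply: le_trans (hull_defect_lipschitz _ _ _ _) _.
  rewrite -/L.
  apply: (@le_trans _ _ (L * d)).
    rewrite ler_wpM2l//; apply/rV_norm_le; first exact: ltW.
    move=> i; have /andP[h1 h2] := lE i.
    have -> : (map_mx ratr l - \row_j w j) 0 i = ratr (l 0 i) - w i by rewrite !mxE.
    by rewrite ger0_norm; lra.
  rewrite /d mulrCA ler_piMr ?(ltW m0)// ler_pdivrMr ?ltr_pwDl//; lra.
move=> h.
pose K := [set l : 'rV[R]_N | forall i, l ord0 i \in `[0, 2]].
have cK : compact K.
  rewrite /K; apply: (@rV_compact R N (fun=> `[0, 2]%classic)) => i; exact: segment_compact.
have cI : compact (hull_defect X y @` K).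
  apply: continuous_compact => //; apply: continuous_subspaceT.
  exact: lipschitz_rV_continuous (hull_defect_lipschitz X y).
have [l Kl l0] : (hull_defect X y @` K) 0.
  apply: (compact_closed (@norm_hausdorff _ _) cI) => B /nbhs_ballP[e /= e0 eB].
  have [m me] : exists m : nat, m.+1%:R^-1 < e.
    by have := near_infty_natSinv_lt (PosNum e0) => /filter_ex[m]; exists m.
  have [l l02 hl] := h m.
  exists (hull_defect X y (map_mx ratr l)); split.
    by exists (map_mx ratr l) => // i; rewrite mxE in_itv/= l02.
  apply: eB; rewrite -ball_normE /ball_/= sub0r normrN ger0_norm ?addr_ge0//.
  exact: le_lt_trans me.
have /eqP := l0; rewrite paddr_eq0// !normr_eq0 !subr_eq0 => /andP[/eqP l1 /eqP yl].
exists (fun i => l 0 i); split => // i.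
by have := Kl i; rewrite in_itv/= => /andP[].
Qed.

Lemma measurable_conv_hull d (T : measurableType d) n N (X : 'I_N -> T -> 'rV[R]_n)
  (Y : T -> 'rV[R]_n) : (forall i, mvec (X i)) -> mvec Y ->
  measurable [set t | conv_hull (fun i => X i t) (Y t)].
Proof.
move=> mX mY.
pose F m (l : 'rV[rat]_N) := if `[< forall i, 0 <= (ratr (l 0 i) : R) <= 2 >]
  then [set t | hull_defect (fun i => X i t) (Y t) (map_mx ratr l) <= m.+1%:R^-1] else set0.
rewrite (_ : [set t | _] = \bigcap_m \bigcup_l F m l); last first.
  apply/funext => t; apply/propext; split => /=.
    move=> /conv_hullP h m _; have [l l02 hl] := h m; exists l => //.
    by rewrite /F asboolT.
  move=> h; apply/conv_hullP => m; have [l _] := h m I.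
  by rewrite /F; case: ifPn => // /asboolP l02 /= hl; exists l.
apply: bigcapT_measurable => m; apply: countable_bigcupT_measurable; first exact: countableP.
move=> l; rewrite /F; case: ifP => // _.
apply: measurable_set_le; last exact: measurable_cst.
apply: measurable_funD; first exact: measurable_cst.
apply: measurable_norm_mvec; apply: mvecB => // i.
have -> : (fun t => (\sum_j (map_mx ratr l) 0 j *: X j t) 0 i) =
    (fun t => \sum_j (map_mx ratr l) 0 j * X j t 0 i).
  by apply/funext => t; rewrite summxE; apply: eq_bigr => j _; rewrite mxE.
by apply: measurable_sum => j; apply: measurable_funM => //; exact: mX.
Qed.

End hull.

Lemma sum_cst_ereal {R : realType} N (c : \bar R) : (0 <= c)%E ->
  (\sum_(i < N) c = (N%:R)%:E * c)%E.
Proof.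
move=> c0; elim: N => [|N IH]; first by rewrite big_ord0 mul0e.
by rewrite big_ord_recr/= IH -addn1 natrD EFinD ge0_muleDl ?lee_fin// mul1e.
Qed.

Section polytope.
Context {R : realType} {n : nat} (mu : probability (Rn R n) R).

Definition sample_nth N (w : sample mu N) (i : nat) : 'rV[R]_n :=
  @pow_nth R (prob_sfspace mu) 'rV[R]_n (@vecn R n) 0 N w i.

Lemma mvec_sample_nth N i : mvec (fun w : sample mu N => sample_nth w i).
Proof.
elim: N i => [|N IH] i; first exact: mvec_cst.
case: i => [|i] /=.
  exact: (mvec_comp (@mvec_vecn R n) (@measurable_hd _ _ mu N)).
exact: (mvec_comp (IH i) (@measurable_tl _ _ mu N)).
Qed.

Lemma integral_sample_nth N i (h : 'rV[R]_n -> \bar R) : (i < N)%N ->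
  measurable_fun setT (h \o @vecn R n) -> (forall v, 0 <= h v)%E ->
  (\int[prod_pow mu N]_w h (sample_nth w i) = \int[mu]_y h (vecn y))%E.
Proof.
move=> + mh h0; elim: N i => [//|N IH] i iN.
have mG : measurable_fun setT (fun w : sample mu N.+1 => h (sample_nth w i)).
  exact: (mvec_rn mh (@mvec_sample_nth N.+1 i)).
rewrite (integral_prod_powS mG)//.
case: i iN mG => [|i] iN mG /=.
  apply: eq_integral => y _.
  rewrite (integral_cst _ measurableT (h (vecn y))).
  by rewrite [X in (_ * X)%E]prod_pow_setT mule1.
under eq_integral do rewrite (_ : (fun w => _) = (fun w : sample mu N => h (sample_nth w i)))// (IH i)//.
rewrite (integral_cst mu measurableT) [X in (_ * X)%E](_ : _ = 1%E) ?mule1//.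
exact: probability_setT.
Qed.

Lemma measurable_hull_pair N :
  measurable [set z : sample mu N * Rn R n | conv_hull (sample_pt z.1) (vecn z.2)].
Proof.
apply: (@measurable_conv_hull _ _ _ _ _ (fun i z => sample_pt z.1 i) (fun z => vecn z.2)).
  move=> i; apply: (mvec_comp (@mvec_sample_nth N i)).
  exact: (@measurable_fst _ _ (sample mu N) (Rn R n)).
apply: (mvec_comp (@mvec_vecn R n)).
exact: (@measurable_snd _ _ (sample mu N) (Rn R n)).
Qed.

Definition hull_prob N (x : 'rV[R]_n) : R :=
  fine (prod_pow mu N [set w | conv_hull (sample_pt w) x]).

Lemma measurable_hull N x : measurable [set w : sample mu N | conv_hull (sample_pt w) x].
Proof.
have := measurable_slice2 (unvec x) (@measurable_hull_pair N); congr measurable.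
by apply/funext => w; apply/propext; rewrite /= unvecK.
Qed.

(* [k] independent polytopes all containing [x] produce, by convexity of [C], a choice of one
   vertex from each whose sum leaves [C]; this is the induction on [k], with shift [a]. *)
Lemma hull_prob_exp N k (C : set 'rV[R]_n) (a x : 'rV[R]_n) :
  closed C -> (forall u v, C u -> C v -> C (2^-1 *: (u + v))) -> ~ C (a + k%:R *: x) ->
  ((hull_prob N x ^+ k)%:E <=
    (N%:R ^+ k)%:E * prod_pow mu k [set w | ~ C (a + sample_sum w)%R])%E.
Proof.
move=> cC midC.
have mC k' : measurable [set z : sample mu k' * Rn R n | ~ C (vecn z.2 + sample_sum z.1)].
  apply: measurableC; apply: (measurable_closed_mvec _ cC).
  apply: mvecD.
    apply: (mvec_comp (@mvec_vecn R n)).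
    exact: (@measurable_snd _ _ (sample mu k') (Rn R n)).
  apply: (mvec_comp (@mvec_sample_sum _ _ mu k')).
  exact: (@measurable_fst _ _ (sample mu k') (Rn R n)).
have mCa k' b : measurable [set w : sample mu k' | ~ C (b + sample_sum w)].
  have := measurable_slice2 (unvec b) (mC k'); congr measurable.
  by apply/funext => w; apply/propext; rewrite /= unvecK.
elim: k a => [|k IH] a.
  rewrite scale0r addr0 !expr0 mul1e => nC.
  rewrite (_ : [set w | _] = setT) ?prod_pow_setT//.
  by apply/seteqP; split => // w _ /=; rewrite addr0.
move=> nC.
pose T b := prod_pow mu k [set w | ~ C (b + sample_sum w)].
have mT b : measurable_fun setT ((fun v => T (b + v)) \o @vecn R n).
  apply: (mvec_rn (Phi := T) (X := fun y => b + vecn y)).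
    exact: (measurable_section2 (prod_pow mu k) (mC k)).
  by apply: mvecD; [exact: mvec_cst|exact: mvec_vecn].
have mE := @measurable_hull N x.
set E := [set w | _] in mE.
have TS : prod_pow mu k.+1 [set w | ~ C (a + sample_sum w)%R] = (\int[mu]_y T (a + vecn y)%R)%E.
  rewrite prod_powS; apply: eq_integral => y _; congr (prod_pow mu k _).
  by apply/funext => w /=; rewrite addrA.
have -> : ((hull_prob N x ^+ k.+1)%:E =
    \int[prod_pow mu N]_w ((hull_prob N x ^+ k)%:E * (\1_E w)%:E))%E.
  rewrite ge0_integralZl_EFin ?exprn_ge0 ?fine_ge0//; last first.
    by apply/measurable_EFinP; exact: measurable_indic.
  by rewrite integral_indic// setIT exprSr EFinM /hull_prob prod_pow_fineK.
(* Every vertex of one polytope has law [mu], so drawing the first summand from [mu] can be traded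
   for the average over its [N] vertices. *)
have -> : ((N%:R ^+ k.+1)%:E * prod_pow mu k.+1 [set w | ~ C (a + sample_sum w)%R] =
    \int[prod_pow mu N]_w (\sum_(i < N) ((N%:R ^+ k)%:E * T (a + sample_nth w i)%R)))%E.
  rewrite ge0_integral_sum//; last 2 first.
  - move=> i; apply: measurable_funeM; exact: (mvec_rn (mT a) (@mvec_sample_nth N i)).
  - by move=> i w _; rewrite mule_ge0// lee_fin exprn_ge0.
  rewrite (eq_bigr (fun=> (N%:R ^+ k)%:E * \int[mu]_y T (a + vecn y)%R))%E; last first.
    move=> i _; rewrite ge0_integralZl_EFin ?exprn_ge0//; last first.
      exact: (mvec_rn (mT a) (@mvec_sample_nth N i)).
    by rewrite (@integral_sample_nth N i (fun v => T (a + v)%R) (ltn_ord i) (mT a)).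
  by rewrite sum_cst_ereal ?mule_ge0 ?integral_ge0 ?lee_fin ?exprn_ge0// TS
    exprSr EFinM muleA [(_%:E * _%:E)%E]muleC.
apply: ge0_le_integral => //.
- by move=> w _; rewrite mule_ge0 ?lee_fin// exprn_ge0// fine_ge0.
- by apply: measurable_funeM; apply/measurable_EFinP; exact: measurable_indic.
- apply: emeasurable_sum => i; apply: measurable_funeM.
  exact: (mvec_rn (mT a) (@mvec_sample_nth N i)).
move=> w _; rewrite indicE.
have s0 (i : 'I_N) : (0 <= (N%:R ^+ k)%:E * T (a + sample_nth w i)%R)%E.
  by rewrite mule_ge0// lee_fin exprn_ge0.
have [|_] := boolP (w \in E); last by rewrite mule0 sume_ge0.
rewrite inE mule1 => -[l [l0 [l1 xl]]].
(* If all these points were in [C], their mean with the weights of [x] would be [a + x + k x], which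
   is not in [C]. *)
have [i nCi] : exists i : 'I_N, ~ C (a + sample_nth w i + k%:R *: x).
  apply: contrapT => /forallNP h; apply: nC.
  have := @closed_midpoint_convex _ _ _ C (fun i : 'I_N => a + sample_nth w i + k%:R *: x) l cC midC
    (fun i => contrapT (h i)) l0 l1.
  congr C.
  under eq_bigr do rewrite addrAC scalerDr.
  rewrite big_split/= -scaler_suml l1 scale1r -xl -addrA; congr (_ + _).
  by rewrite -natr1 scalerDl scale1r.
apply: le_trans (IH _ nCi) _.
by rewrite (bigD1 i)//= leeDl// sume_ge0.
Qed.

End polytope.

(** * Densities, the isotropic constant and the choice of [k] *)

Section final.
Context {R : realType}.

Lemma lebn_setT_gt0 n : (0 < lebn R n setT)%E.
Proof.
apply: (@lt_le_trans _ _ (lebn R n [set x | `|(0 : 'rV[R]_n) - 1 *: vecn x| <= 1])).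
  by rewrite lebn_box// lte_fin exprn_gt0// divr1 mulr1.
apply: le_measure; rewrite ?inE//.
apply: measurable_set_le; last exact: measurable_cst.
apply: measurable_norm_mvec; apply: mvecB; first exact: mvec_cst.
by apply: mvecZ; exact: mvec_vecn.
Qed.

Lemma sup_norm_ge0 n (nu : probability (Rn R n) R) g : is_density nu g -> (0 <= sup_norm g)%E.
Proof.
by move=> [_ [g0 _]]; apply: ess_sup_ger => [|t]; [exact: lebn_setT_gt0|rewrite lee_fin].
Qed.

Lemma density_le n (nu : probability (Rn R n) R) g (M : R) S :
  is_density nu g -> sup_norm g = M%:E -> measurable S ->
  (nu S <= M%:E * lebn R n S)%E.
Proof.
move=> dg; have := sup_norm_ge0 dg; move: dg => [mg [g0 gE]] + gM mS.
rewrite gE// gM => M0.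
have gle : {ae lebn R n, forall x, ((g x)%:E <= M%:E)%E}.
  by rewrite -gM; exact: ess_sup_ge.
rewrite -integral_cst//.
apply: ae_ge0_le_integral => //.
- by move=> x _; rewrite lee_fin.
- by apply/measurable_EFinP; apply: measurable_funS mg.
- by apply: filterS gle => x.
Qed.

Lemma isotropic_constX n (mu : probability (Rn R n) R) f : (0 < n)%N ->
  0 < fine (sup_norm f) -> 0 < \det (Cov mu) ->
  isotropic_const mu f ^+ n = fine (sup_norm f) * Num.sqrt (\det (Cov mu)).
Proof.
move=> n0 M0 D0; rewrite /isotropic_const exprMn.
have nn : n%:R != 0 :> R by rewrite pnatr_eq0 -lt0n.
rewrite -!powR_mulrn ?powR_ge0// -!powRrM mulVf// powRr1 ?ltW//; congr (_ * _).
by rewrite invfM mulfVK// powR12_sqrt ?ltW.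
Qed.

Lemma prod_pow1 n (mu : probability (Rn R n) R) (C : set 'rV[R]_n) : closed C ->
  prod_pow mu 1 [set w | ~ C (sample_sum w)] = mu [set x | ~ C (vecn x)].
Proof.
move=> cC; have mC : measurable [set x : Rn R n | ~ C (vecn x)].
  by apply: measurableC; exact: measurable_closed_vecn.
rewrite prod_powS -[in RHS](setIT [set x | ~ C (vecn x)]) -integral_indic//.
apply: eq_integral => y _; rewrite indicE.
have [h|h] := pselect (C (vecn y)).
  rewrite memNset; last by move=> /(_ h).
  by rewrite (_ : [set w | _] = set0) ?measure0// -subset0 => w /=; rewrite addr0 => /(_ h).
rewrite mem_set// (_ : [set w | _] = setT) ?prod_pow_setT//.
by apply/seteqP; split => // w _ /=; rewrite addr0.
Qed.

Lemma concentration_density n (mu nu : probability (Rn R n) R) f g k :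
  log_concave mu -> centered mu -> is_density nu g -> sup_norm f = sup_norm g ->
  (0 < n)%N -> (0 < k)%N -> 0 < isotropic_const mu f ->
  exists C : set 'rV[R]_n,
    [/\ closed C, forall a b, C a -> C b -> C (2^-1 *: (a + b)),
       (prod_pow mu k [set w | ~ C (sample_sum w)] <= (expR (- (2 * n%:R)))%:E)%E &
       (nu [set x | C (k%:R *: vecn x)] <=
          ((vol_const * isotropic_const mu f / Num.sqrt k%:R) ^+ n)%:E)%E].
Proof.
move=> lc cen dg fg n0 k0 L0.
have [C [cC midC hC volC]] := concentration_set lc cen n0 k0.
have D0 := Cov_det_gt0 lc cen.
(* A positive isotropic constant excludes an infinite supremum as well, because [fine] sends [+oo]
   to 0. *)
have M0 : 0 < fine (sup_norm f).
  rewrite lt_def fine_ge0 ?andbT; last by rewrite fg; exact: sup_norm_ge0 dg.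
  apply/eqP => E; move: L0; rewrite /isotropic_const E powR0 ?mul0r ?ltxx//.
  by rewrite invr_eq0 pnatr_eq0 -lt0n.
have sE : sup_norm g = (fine (sup_norm f))%:E.
  by rewrite -fg; move: M0; case: (sup_norm f) => //=; rewrite ltxx.
exists C; split => //.
have mS : measurable [set x : Rn R n | C (k%:R *: vecn x)].
  by apply: (measurable_closed_mvec _ cC); apply: mvecZ; exact: mvec_vecn.
apply: le_trans (density_le dg sE mS) _.
apply: le_trans (lee_wpmul2l _ volC) _; first by rewrite lee_fin ltW.
rewrite -EFinM lee_fin mulrCA -(isotropic_constX n0 M0 D0) -exprMn.
by rewrite mulrAC.
Qed.

(** The set [C] and its complement cover the space, so [1 <= a ^+ n + expR (- (2 * n))] with [a] the
    constant on the right; [a < 1/2] would make this at most [1/2 + 1/3]. *)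
Lemma isotropic_const_ge n (mu : probability (Rn R n) R) f :
  log_concave mu -> centered mu -> is_density mu f -> (0 < n)%N ->
  0 < isotropic_const mu f -> 1 <= 2 * (vol_const * isotropic_const mu f).
Proof.
move=> lc cen df n0 L0.
have [C [cC _ hC hS]] := concentration_density lc cen df erefl n0 (ltn0Sn 0) L0.
move: hC hS; rewrite (prod_pow1 mu cC) sqrtr1 divr1.
have E : [set x : Rn R n | C (1%:R *: vecn x)] = [set x | C (vecn x)].
  by apply/funext => x; rewrite /= scale1r.
rewrite E => {E}.
set a := vol_const * _.
have a0 : 0 <= a by rewrite mulr_ge0// ltW// vol_const_gt0.
have mS : measurable [set x : Rn R n | C (vecn x)] by exact: measurable_closed_vecn.
move=> h1 h2; have := leeD h2 h1.
rewrite -measureU//; last 2 first.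
- exact: measurableC.
- by rewrite -subset0 => x [].
rewrite (_ : _ `|` _ = setT); last by apply/seteqP; split => // x _ /=; exact: EM.
rewrite [X in (X <= _)%E](_ : _ = 1%E); last exact: probability_setT.
rewrite -EFinD lee_fin => h.
rewrite leNgt; apply/negP => a1.
have a12 : a <= 2^-1 by lra.
have h3 : a ^+ n <= a.
  rewrite -[leRHS]expr1; apply: ler_wiXn2l => //; lra.
have h4 : expR (- (2 * n%:R)) <= 3^-1 :> R.
  rewrite expRN lef_pV2 ?posrE ?expR_gt0//.
  have := expR_ge1Dx (2 * n%:R : R).
  have : 1 <= n%:R :> R by rewrite ler1n.
  lra.
lra.
Qed.

End final.

Theorem theorem5p4 (R : realType) :
  exists c1 c2 : R, 0 < c1 /\ 0 < c2 /\
  forall (n : nat) (mu nu : probability (Rn R n) R) (f g : Rn R n -> R),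
    (0 < n)%N ->
    log_concave mu -> log_concave nu -> centered mu -> centered nu ->
    is_density mu f -> is_density nu g -> sup_norm f = sup_norm g ->
    forall N : nat, (n < N)%N ->
      N%:R <= expR (c1 * n%:R / isotropic_const mu f ^+ 2) ->
      (\int[prod_pow mu N]_w nu (random_polytope w)
         <= (2 * expR (- (c2 * n%:R / isotropic_const mu f ^+ 2)))%:E)%E.
Proof.
have A0 := @vol_const_gt0 R; set A := @vol_const R in A0.
pose x1 := expR 1 * A.
have x10 : 0 < x1 by rewrite mulr_gt0// expR_gt0.
(* With [x = x1 * L] one gets [c / L ^+ 2 = 1 / (2 * x ^+ 2)], which is at most [1 / k] as soon as
   [k <= 2 * x ^+ 2]. *)
pose c := (2 * x1 ^+ 2)^-1.
have c0 : 0 < c by rewrite invr_gt0 mulr_gt0// exprn_gt0.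
exists c, c; split => //; split => //.
move=> n mu nu f g n0 lc _ cen _ df dg fg N nN.
set L := isotropic_const mu f => NL.
(* Were [L] zero, the quotient would be 0 by convention and the hypothesis would read [N <= 1],
   against [n < N]. *)
have L0 : 0 < L.
  rewrite lt_def mulr_ge0 ?powR_ge0// andbT; apply/eqP => L0; move: NL.
  rewrite L0 expr0n invr0 mulr0 expR0 leNgt => /negP; apply.
  by rewrite ltr1n (leq_trans _ nN).
have nR : 1 <= n%:R :> R by rewrite ler1n.
have AL := isotropic_const_ge lc cen df n0 L0; rewrite -/A -/L in AL.
have e2 : 2 <= expR 1 :> R by have := expR_ge1Dx (1 : R); lra.
pose x := x1 * L.
(* The lower bound on [L] enters here: it ensures that rounding [x ^+ 2] up to the integer [k] at
   most doubles it. *)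
have x1' : 1 <= x.
  by rewrite /x /x1 -mulrA; have := ler_wpM2r (ltW (mulr_gt0 A0 L0)) e2; lra.
pose k := (Num.truncn (x ^+ 2)).+1.
have k1 : x ^+ 2 <= k%:R by apply: ltW; exact: truncnS_gt.
have x20 : 1 <= x ^+ 2 by rewrite exprn_ege1.
have k2 : k%:R <= 2 * x ^+ 2.
  have : (Num.truncn (x ^+ 2))%:R <= x ^+ 2 by rewrite truncn_le// (le_trans ler01).
  by rewrite /k -natr1; lra.
have k0 : 0 < k%:R :> R by [].
have [C [cC midC hC hS]] := concentration_density lc cen dg fg n0 (ltn0Sn _ : (0 < k)%N) L0.
rewrite -/A -/L in hS.
pose E := expR (- (c * n%:R / L ^+ 2)).
have cL : c / L ^+ 2 = (2 * x ^+ 2)^-1.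
  by rewrite /c /x; field; rewrite !gt_eqF.
have E0 : 0 < E by exact: expR_gt0.
set S := [set y | _] in hS.
have mS : measurable S.
  by apply: (measurable_closed_mvec _ cC); apply: mvecZ; exact: mvec_vecn.
have hSE : (nu S <= E%:E)%E.
  apply: le_trans hS _; rewrite lee_fin.
  apply: (@le_trans _ _ (expR (- 1) ^+ n)).
    have hb : A * L / Num.sqrt k%:R <= expR (- 1).
      rewrite ler_pdivrMr ?sqrtr_gt0// expRN [leRHS]mulrC ler_pdivlMr ?expR_gt0//.
      rewrite [leLHS]mulrC mulrA -/x1 -/x.
      rewrite -(@ler_pXn2r _ 2) ?nnegrE ?sqrtr_ge0 ?(le_trans ler01 x1')//.
      by rewrite sqr_sqrtr// ltW.
    apply: lerXn2r => //; rewrite nnegrE ?expR_ge0//.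
    by rewrite divr_ge0 ?sqrtr_ge0// ltW// mulr_gt0.
  rewrite -expRM_natl ler_expR mulrN1 lerN2 mulrAC cL ler_piMl ?ler0n//.
  by rewrite invf_le1; lra.
have hull y : ~ C (k%:R *: vecn y) -> hull_prob mu N (vecn y) <= E.
  move=> nC.
  have := @hull_prob_exp _ _ mu N k C 0 (vecn y) cC midC; rewrite add0r => /(_ nC).
  under eq_set do rewrite add0r.
  move=> h; have {h} := le_trans h (lee_wpmul2l _ hC).
  rewrite lee_fin exprn_ge0// => /(_ isT); rewrite -EFinM lee_fin.
  (* Taking [k]-th roots leaves [N * expR (- (2 * n / k))]; the bound on [N] uses up at most half of
     this exponent. *)
  have -> : expR (- (2 * n%:R)) = expR (- (2 * n%:R / k%:R)) ^+ k :> R.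
    by rewrite -expRM_natl; congr expR; field; rewrite gt_eqF.
  rewrite -exprMn ler_pXn2r ?nnegrE ?fine_ge0 ?mulr_ge0 ?expR_ge0// => h.
  apply: le_trans h _; apply: le_trans (ler_wpM2r (expR_ge0 _) NL) _.
  rewrite -expRD ler_expR mulrAC cL.
  have h2 : 2 * ((2 * x ^+ 2)^-1 * n%:R) <= 2 * n%:R / k%:R.
    have -> : 2 * n%:R / k%:R = 2 * (k%:R^-1 * n%:R) :> R by rewrite -mulrA [n%:R / _]mulrC.
    by rewrite ler_wpM2l// ler_wpM2r// lef_pV2 ?posrE//; lra.
  lra.
rewrite (_ : (\int[prod_pow mu N]_w nu (random_polytope w))%E =
  (\int[nu]_y (hull_prob mu N (vecn y))%:E)%E); last first.
  have := tonelli_set (prod_pow mu N) nu (@measurable_hull_pair _ _ mu N).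
  move=> -> ; apply: eq_integral => y _.
  by rewrite /hull_prob prod_pow_fineK//; exact: measurable_hull.
have mh : measurable_fun setT (fun y => (hull_prob mu N (@vecn R n y))%:E).
  have := measurable_section2 (prod_pow mu N) (@measurable_hull_pair _ _ mu N).
  congr measurable_fun; apply/funext => y.
  by rewrite /hull_prob prod_pow_fineK//; exact: measurable_hull.
(* On [S] the hull probability is at most 1, off [S] at most [E]; since [nu S <= E], the two
   contributions account for the factor 2. *)
apply: (@le_trans _ _ (\int[nu]_y ((\1_S y)%:E + E%:E))%E).
  apply: ge0_le_integral => //.
  - by move=> y _; rewrite lee_fin fine_ge0.
  - by apply: emeasurable_funD => //; apply/measurable_EFinP; exact: measurable_indic.
  move=> y _; rewrite indicE -EFinD lee_fin.
  have [yS|yS] := pselect (S y); last by rewrite memNset// add0r; exact: hull.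
  rewrite mem_set//.
  rewrite -lee_fin /hull_prob prod_pow_fineK; last exact: measurable_hull.
  apply: le_trans (prod_pow_le1 (@measurable_hull _ _ mu N _)) _.
  by rewrite lee_fin lerDl ltW.
rewrite ge0_integralD//; last 2 first.
- by apply/measurable_EFinP; exact: measurable_indic.
- by move=> y _; rewrite lee_fin ltW.
rewrite integral_indic// setIT (integral_cst nu measurableT E%:E).
rewrite [X in (_ + _ * X)%E](_ : _ = 1%E); last exact: probability_setT.
by rewrite mule1 -/E mulr_natl mulr2n EFinD leeD.
Qed.
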